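(* Let $a<b$, $N\in\mathbb{N}$, $\alpha,\beta\in(0,1)$, $\gamma\in[0,1]$, $L\in C^1([a,b]\times\mathbb{R}^{3N};\mathbb{R})$, and $\mathbf{y}^a,\mathbf{y}^b\in\mathbb{R}^N$. Consider the problem of minimizing $$\mathcal{J}(y)=\int_a^b L\left(x,y(x),y'(x),{}^{C}D^{\alpha,\beta}_{\gamma}y(x)\right)dx$$ over all $y\in\mathbf{D}$ subject to the boundary conditions $y(a)=\mathbf{y}^a$, $y(b)=\mathbf{y}^b$. If $y=(y_1,\ldots,y_N)$ is a local minimizer to this problem, then $y$ satisfies the system of $N$ Euler--Lagrange equations $$\partial_i L[y]^{\alpha,\beta}_{\gamma}(x)-\frac{d}{dx}\partial_{N+i}L[y]^{\alpha,\beta}_{\gamma}(x)+D^{\beta,\alpha}_{1-\gamma}\,\partial_{2N+i}L[y]^{\alpha,\beta}_{\gamma}(x)=0,\qquad i=2,\ldots,N+1,$$ for all $x\in[a,b]$.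
   Context: Fractional integrals: for $f\in L_1([a,b])$ and $0<\mu<1$, ${}_aI_x^{\mu}f(x)=\frac{1}{\Gamma(\mu)}\int_a^x(x-t)^{\mu-1}f(t)\,dt$ and ${}_xI_b^{\mu}f(x)=\frac{1}{\Gamma(\mu)}\int_x^b(t-x)^{\mu-1}f(t)\,dt$ (left and right Riemann--Liouville integrals). Riemann--Liouville derivatives: ${}_aD_x^{\mu}f(x)=\frac{d}{dx}\,{}_aI_x^{1-\mu}f(x)$ and ${}_xD_b^{\mu}f(x)=-\frac{d}{dx}\,{}_xI_b^{1-\mu}f(x)$. Caputo derivatives, for $f$ absolutely continuous on $[a,b]$: ${}^C_aD_x^{\mu}f(x)={}_aI_x^{1-\mu}(f')(x)$ and ${}^C_xD_b^{\mu}f(x)={}_xI_b^{1-\mu}(-f')(x)$. Combined derivatives: ${}^{C}D^{\alpha,\beta}_{\gamma}=\gamma\,{}^C_aD_x^{\alpha}+(1-\gamma)\,{}^C_xD_b^{\beta}$, applied componentwise to vector functions, and $D^{\beta,\alpha}_{1-\gamma}=(1-\gamma)\,{}_aD_x^{\beta}+\gamma\,{}_xD_b^{\alpha}$. $\mathbf{D}$ is the set of all functions $y:[a,b]\to\mathbb{R}^N$ such that $y'$ and ${}^{C}D^{\alpha,\beta}_{\gamma}y$ exist and are continuous on $[a,b]$, with norm $\|y\|_{1,\infty}=\max_{[a,b]}\|y(x)\|+\max_{[a,b]}\|y'(x)\|+\max_{[a,b]}\|{}^{C}D^{\alpha,\beta}_{\gamma}y(x)\|$, where $\|\cdot\|$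 is a norm on $\mathbb{R}^N$. A function in $\mathbf{D}$ satisfying all constraints of the problem is called admissible; $\mathcal{D}$ is the set of admissible functions. A function $\overline{y}\in\mathcal{D}$ is a local minimizer if there is $\delta>0$ such that $\mathcal{J}(\overline{y})\le\mathcal{J}(y)$ for all $y\in\mathcal{D}$ with $\|y-\overline{y}\|_{1,\infty}<\delta$. Notation: $[y]^{\alpha,\beta}_{\gamma}(x)=(x,y(x),y'(x),{}^{C}D^{\alpha,\beta}_{\gamma}y(x))$, a point of $[a,b]\times\mathbb{R}^{3N}$; $\partial_iL$ is the partial derivative of $L$ with respect to its $i$-th scalar argument (the first argument being $x$), so that for $i=2,\dots,N+1$ the derivatives $\partial_i,\partial_{N+i},\partial_{2N+i}$ are with respect to the $(i-1)$-th components of $y$, $y'$ and ${}^{C}D^{\alpha,\beta}_{\gamma}y$; $\partial_iL[y]^{\alpha,\beta}_{\gamma}(x)$ denotes $\partial_iL$ evaluated at $[y]^{\alpha,\beta}_{\gamma}(x)$.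
   Formalization: The two derivatives need not exist separately (e.g. at x=a for L=y'^2/2+v, γ=0), so the equation is proved for all x with the derivatives grouped as one derivative of the combined argument, and term by term as displayed wherever the fractional derivative of ∂_{2N+i}L exists. *)

(* Defs.v *)
(* Functions on the interval from [a] to [b] are encoded as total functions on
   [R] of which only the values on [`[a, b]] are ever used. *)
From mathcomp Require Import all_boot all_order all_algebra.
From mathcomp Require Import all_classical all_reals all_analysis.

Set Implicit Arguments.
Unset Strict Implicit.
Unset Printing Implicit Defensive.

Import Order.TTheory GRing.Theory Num.Theory.
Import numFieldNormedType.Exports.

Local Open Scope classical_set_scope.
Local Open Scope ring_scope.

Section Scalar.
Context {R : realType}.
Implicit Types (a b c mu nu x : R) (f : R -> R).

(* Derivatives are taken along points of [`[a, b]], hence two-sided in the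
   interior and one-sided at [a] and [b]. *)
Definition diff_quotient f x : R -> R := fun t => (f t - f x) / (t - x).

Definition derivable_on a b f x :=
  cvg (diff_quotient f x @ within `[a, b] x^').

Definition deriv_on a b f x : R :=
  lim (diff_quotient f x @ within `[a, b] x^').

Definition Gamma (s : R) : R :=
  \int[lebesgue_measure]_(t in `]0, +oo[) (t `^ (s - 1) * expR (- t)).

(* [0 `^ (mu - 1) = 0] when [mu < 1]; this only affects the null set [t = x]. *)
Definition rl_intl a mu f x : R :=
  (Gamma mu)^-1 *
  \int[lebesgue_measure]_(t in `[a, x]) ((x - t) `^ (mu - 1) * f t).

Definition rl_intr b mu f x : R :=
  (Gamma mu)^-1 *
  \int[lebesgue_measure]_(t in `[x, b]) ((t - x) `^ (mu - 1) * f t).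

Definition rl_derivl a b mu f x : R := deriv_on a b (rl_intl a (1 - mu) f) x.

Definition rl_derivr a b mu f x : R := - deriv_on a b (rl_intr b (1 - mu) f) x.

Definition caputol a b mu f x : R := rl_intl a (1 - mu) (deriv_on a b f) x.

Definition caputor a b mu f x : R :=
  rl_intr b (1 - mu) (fun t => - deriv_on a b f t) x.

Definition caputo_comb a b mu nu c f x : R :=
  c * caputol a b mu f x + (1 - c) * caputor a b nu f x.

Definition rl_comb a b mu nu c f x : R :=
  c * rl_derivl a b mu f x + (1 - c) * rl_derivr a b nu f x.

(* A one-sided derivative with coefficient [0] is absent from [rl_comb], so it
   is not required to exist. *)
Definition rl_comb_exists a b mu nu c f x : Prop :=
  (c != 0 -> derivable_on a b (rl_intl a (1 - mu) f) x) /\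
  (c != 1 -> derivable_on a b (rl_intr b (1 - nu) f) x).

(* The function whose derivative is [rl_comb a b mu nu c f] wherever
   [rl_comb_exists a b mu nu c f]. *)
Definition rl_comb_int a b mu nu c f x : R :=
  c * rl_intl a (1 - mu) f x - (1 - c) * rl_intr b (1 - nu) f x.

End Scalar.

Section Vector.
Context {R : realType} {N : nat}.
Implicit Types (a b al be ga x : R) (y z : R -> 'rV[R]_N).

Definition is_norm (nrm : 'rV[R]_N -> R) : Prop :=
  [/\ forall u v, nrm (u + v) <= nrm u + nrm v,
      forall k u, nrm (k *: u) = `|k| * nrm u
    & forall u, nrm u = 0 -> u = 0].

Definition vderiv_on a b y x : 'rV[R]_N :=
  \row_i deriv_on a b (fun t => y t 0 i) x.

Definition vcaputo a b al be ga y x : 'rV[R]_N :=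
  \row_i caputo_comb a b al be ga (fun t => y t 0 i) x.

(* The space D; the Caputo derivatives of a function with continuous
   derivative are integrals of integrable functions, so only their continuity
   has to be required. *)
Definition in_D a b al be ga y : Prop :=
  [/\ forall i x, x \in `[a, b] -> derivable_on a b (fun t => y t 0 i) x,
      {within `[a, b], continuous (vderiv_on a b y)}
    & {within `[a, b], continuous (vcaputo a b al be ga y)}].

(* On continuous functions the supremum is a maximum. *)
Definition max_norm (nrm : 'rV[R]_N -> R) a b y : R :=
  sup [set nrm (y x) | x in `[a, b]].

Definition norm1oo (nrm : 'rV[R]_N -> R) a b al be ga y : R :=
  max_norm nrm a b y + max_norm nrm a b (vderiv_on a b y)
  + max_norm nrm a b (vcaputo a b al be ga y).


Definition lift_curve a b al be ga y x : R * 'rV[R]_N * 'rV[R]_N * 'rV[R]_N :=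
  (x, y x, vderiv_on a b y x, vcaputo a b al be ga y x).

Implicit Types (L : R * 'rV[R]_N * 'rV[R]_N * 'rV[R]_N -> R)
  (p : R * 'rV[R]_N * 'rV[R]_N * 'rV[R]_N).

Definition slab a b : set (R * 'rV[R]_N * 'rV[R]_N * 'rV[R]_N) :=
  [set p | p.1.1.1 \in `[a, b]].

(* The partial derivative in the first variable is one-sided at [a] and [b],
   since [L] is only meaningful on [slab a b]. *)
Definition along_x L p : R -> R := fun t => L (t, p.1.1.2, p.1.2, p.2).

Definition dx a b L p : R := deriv_on a b (along_x L p) p.1.1.1.

Definition ey (i : 'I_N) : R * 'rV[R]_N * 'rV[R]_N * 'rV[R]_N :=
  (0, delta_mx 0 i, 0, 0).
Definition eyp (i : 'I_N) : R * 'rV[R]_N * 'rV[R]_N * 'rV[R]_N :=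
  (0, 0, delta_mx 0 i, 0).
Definition eD (i : 'I_N) : R * 'rV[R]_N * 'rV[R]_N * 'rV[R]_N :=
  (0, 0, 0, delta_mx 0 i).

Definition dy (i : 'I_N) L p : R := 'D_(ey i) L p.
Definition dyp (i : 'I_N) L p : R := 'D_(eyp i) L p.
Definition dD (i : 'I_N) L p : R := 'D_(eD i) L p.

Definition C1_slab a b L : Prop :=
  [/\ {within slab a b, continuous L},
      forall p, slab a b p ->
        derivable_on a b (along_x L p) p.1.1.1 /\
        forall i, [/\ derivable L p (ey i), derivable L p (eyp i)
                    & derivable L p (eD i)],
      {within slab a b, continuous (dx a b L)}
    & forall i, [/\ {within slab a b, continuous (dy i L)},
                    {within slab a b, continuous (dyp i L)}
                  & {within slab a b, continuous (dD i L)}]].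

Definition functional a b al be ga L y : R :=
  \int[lebesgue_measure]_(x in `[a, b]) L (lift_curve a b al be ga y x).

Definition admissible a b al be ga (ya yb : 'rV[R]_N) y : Prop :=
  [/\ in_D a b al be ga y, y a = ya & y b = yb].

Definition local_minimizer (nrm : 'rV[R]_N -> R) a b al be ga L
    (ya yb : 'rV[R]_N) y : Prop :=
  admissible a b al be ga ya yb y /\
  exists2 delta : R, 0 < delta &
    forall z, admissible a b al be ga ya yb z ->
      norm1oo nrm a b al be ga (z \- y) < delta ->
      functional a b al be ga L y <= functional a b al be ga L z.

(* For a Lagrangian that is merely C^1, the two derivatives d/dx and
   D^(be, al)_(1 - ga) in the Euler-Lagrange equation need not exist separately
   (for instance at [x = a] when N = 1, ga = 0 and L = y'^2 / 2 + Dy), but the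
   derivative of their combined argument always does.  The equation thus reads:
   in combined form unconditionally, and term by term as soon as the fractional
   derivative exists at [x], d/dx then existing as well. *)
Definition euler_lagrange a b al be ga L y (i : 'I_N) x : Prop :=
  let Ly := fun t => dy i L (lift_curve a b al be ga y t) in
  let Lyp := fun t => dyp i L (lift_curve a b al be ga y t) in
  let LD := fun t => dD i L (lift_curve a b al be ga y t) in
  let G := fun t => Lyp t - rl_comb_int a b be al (1 - ga) LD t in
  (derivable_on a b G x /\ Ly x - deriv_on a b G x = 0) /\
  (rl_comb_exists a b be al (1 - ga) LD x ->
   derivable_on a b Lyp x /\
   Ly x - deriv_on a b Lyp x + rl_comb a b be al (1 - ga) LD x = 0).

End Vector.

(* Main.v *)
(* Perturb the i-th component of the minimizer by e h with h(x) = \int_a^x g,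
   g continuous with mean 0, so that h is an admissible variation.  The first
   variation vanishes, and fractional integration by parts (Fubini on the
   triangle a <= t <= x <= b) moves every integral operator off g:
     \int_a^b g(x) (\int_x^b Ly + G(x)) dx = 0,
   where G is Lyp minus the function rl_comb_int of LD.  By du Bois-Reymond,
   \int_x^b Ly + G is constant on [a, b], so G is differentiable with
   derivative Ly, although its two terms need not be. *)

Require Import Defs.
From mathcomp Require Import all_boot all_order all_algebra.
From mathcomp Require Import all_classical all_reals all_analysis.
From mathcomp Require Import measurable_realfun.
From mathcomp Require Import ring lra.

Set Implicit Arguments.
Unset Strict Implicit.
Unset Printing Implicit Defensive.

Import Order.TTheory GRing.Theory Num.Theory.
Import numFieldNormedType.Exports.

Local Open Scope classical_set_scope.
Local Open Scope ring_scope.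

(** * One-sided derivatives on an interval *)

(** The ordinary primitive is the fractional integral of order 1, so h is written [Il a 1 g] and a
    single integration by parts formula serves all orders that occur. Fractional integrals must be
    known to be continuous, both for the admissibility of h, whose Caputo derivatives are fractional
    integrals of g, and for the du Bois-Reymond step. This is not automatic, since the kernel is
    singular at the moving endpoint; it comes from a Hoelder estimate of exponent mu. The C^1
    hypothesis supplies partial derivatives only, and on a slab with boundary. Every variation keeps
    time fixed, so derivatives along it are two-sided on the whole slab, and they are assembled from
    the partial ones by the mean value theorem. Finally, the data are continuous merely within
    [a, b]; composing with the projection [clamp a b] makes them continuous on the line with
    unchanged values on [a, b], the form in which the integration lemmas take their functions. *)

Section IntervalDerivative.
Context {R : realType} {a b : R}.
Hypothesis ab : a < b.
Implicit Types (f g : R -> R) (x k l : R).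

(** A relational form: linear combinations can be handled without knowing that the limit is unique,
    which matters only when passing back to [deriv_on]. *)
Definition has_deriv_on f x l :=
  diff_quotient f x @ within `[a, b] x^' --> l.

(** Every point of [a, b] is a limit of other points of the interval, approached from the right if x
    < b and from the left at b; this is what makes the limit in [deriv_on] unique. *)
Lemma within_dnbhs_proper x : x \in `[a, b] ->
  ProperFilter (within `[a, b] x^').
Proof.
rewrite in_itv/= => /andP[ax xb].
apply: Build_ProperFilter_ex => A /nbhs_ballP[e /= e0 eA].
have [xb'|bx] := ltP x b.
  pose d := Num.min (e / 2) (b - x).
  have d0 : 0 < d by rewrite lt_min subr_gt0 xb' divr_gt0.
  exists (x + d); apply: eA.
  - rewrite /ball/= opprD addNKr normrN gtr0_norm//.
    by rewrite (@le_lt_trans _ _ (e / 2)) ?ge_min ?lexx//; lra.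
  - by rewrite gt_eqF// ltrDl.
  - have db : d <= b - x by rewrite ge_min lexx orbT.
    by rewrite /= in_itv/=; apply/andP; split; lra.
pose d := Num.min (e / 2) (x - a).
have d0 : 0 < d by rewrite lt_min subr_gt0 (lt_le_trans ab bx) divr_gt0.
exists (x - d); apply: eA.
- rewrite /ball/= opprB addrC subrK gtr0_norm//.
  by rewrite (@le_lt_trans _ _ (e / 2)) ?ge_min ?lexx//; lra.
- by rewrite lt_eqF// ltrBlDr ltrDl.
- have db : d <= x - a by rewrite ge_min lexx orbT.
  by rewrite /= in_itv/=; apply/andP; split; lra.
Qed.

Lemma has_deriv_onP f x l : x \in `[a, b] -> has_deriv_on f x l ->
  derivable_on a b f x /\ deriv_on a b f x = l.
Proof.
move=> xab fl; have := within_dnbhs_proper xab => PF.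
split; first by apply/cvg_ex; exists l.
exact: (cvg_lim (@Rhausdorff R)).
Qed.

Lemma derivable_onP f x : derivable_on a b f x ->
  has_deriv_on f x (deriv_on a b f x).
Proof. by []. Qed.

Lemma has_deriv_on_eq f g x l : x \in `[a, b] ->
  {in `[a, b], f =1 g} -> has_deriv_on f x l -> has_deriv_on g x l.
Proof.
move=> xab fg; apply: cvg_trans; apply: near_eq_cvg.
have : within `[a, b] x^' [set` `[a, b]] by exact: withinT.
by apply: filterS => t tab; rewrite /diff_quotient !fg.
Qed.

(** Sums, differences (k = -1) and multiples (f constant 0) are all instances of this one shape, in
    which linearity is stated throughout. *)
Lemma has_deriv_onDZ f g x k l1 l2 :
  has_deriv_on f x l1 -> has_deriv_on g x l2 ->
  has_deriv_on (fun t => f t + k * g t) x (l1 + k * l2).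
Proof.
move=> fl gl.
rewrite /has_deriv_on.
have -> : diff_quotient (fun t => f t + k * g t) x =
    (fun t => diff_quotient f x t + k * diff_quotient g x t).
  by apply/funext => t; rewrite /diff_quotient; ring.
by apply: cvgD => //; apply: cvgMr.
Qed.

Lemma has_deriv_on_cst x k : has_deriv_on (fun=> k) x 0.
Proof.
rewrite /has_deriv_on.
have -> : diff_quotient (fun=> k) x = fun=> 0.
  by apply/funext => t; rewrite /diff_quotient subrr mul0r.
exact: cvg_cst.
Qed.

Lemma derivable_has_deriv_on f x : derivable f x 1 ->
  has_deriv_on f x (f^`()%classic x).
Proof.
move=> df; rewrite /has_deriv_on.
apply: (@cvg_trans _ (diff_quotient f x @ x^')).
  by apply: cvg_app; apply: cvg_within.
apply/cvgr_dnbhsP => t [tx t_x].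
have : h^-1 *: (f (h + x) - f x) @[h --> 0^'] --> f^`()%classic x.
  by rewrite derive1E; move: df; rewrite /derivable/derive;
     under eq_fun do rewrite scaler1.
move/cvgr_dnbhsP => /(_ (fun n => t n - x)) h.
rewrite (_ : (fun n => _) =
    (fun n => (t n - x)^-1 *: (f (t n - x + x) - f x))); last first.
  by apply/funext => n; rewrite /= subrK /diff_quotient mulrC.
apply: h; split; last exact/subr_cvg0.
by move=> n; rewrite subr_eq0.
Qed.

Lemma has_deriv_on_continuous f x l :
  has_deriv_on f x l -> f @ within `[a, b] (nbhs x) --> f x.
Proof.
move=> fl.
have c0 : (f t - f x) @[t --> within `[a, b] x^'] --> 0.
  have -> : 0 = l * (x - x) by rewrite subrr mulr0.
  have : diff_quotient f x t * (t - x) @[t --> within `[a, b] x^']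
      --> l * (x - x).
    apply: cvgM => //; apply: cvgB; last exact: cvg_cst.
    apply: (@cvg_trans _ (id @ x^')).
      by apply: cvg_app; apply: cvg_within.
    by apply: cvg_trans; last exact: cvg_id; apply: cvg_within.
  apply: cvg_trans; apply: near_eq_cvg.
  have : within `[a, b] x^' [set t | t != x].
    by apply: filterS (nbhs_dnbhs_neq x) => t tx _.
  by apply: filterS => t tx; rewrite /diff_quotient divfK// subr_eq0.
apply/cvgrPdist_lt => e e0.
move/cvgrPdist_lt : c0 => /(_ _ e0).
move=> h; have {h} : nbhs x (fun t => t != x -> t \in `[a, b] ->
  `|0 - (f t - f x)| < e) := h.
apply: filterS => t h tab.
have [->|tx] := eqVneq t x; first by rewrite subrr normr0.
by have := h tx tab; rewrite sub0r normrN distrC.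
Unshelve. all: by end_near. Qed.

End IntervalDerivative.

(** * The singular kernel and fractional integrals *)

Section Kernel.
Context {R : realType}.
Notation leb := (@lebesgue_measure R).
Implicit Types (a b c d x y mu : R) (f g : R -> R).

Lemma is_derive_kerl mu x t : 0 < mu -> t < x ->
  is_derive t 1 (fun s => - ((x - s) `^ mu / mu)) ((x - t) `^ (mu - 1)).
Proof.
move=> mu0 tx; have xt0 : 0 < x - t by rewrite subr_gt0.
have h : is_derive t 1 (fun s => x - s) (- 1).
  by rewrite -sub0r; exact: is_deriveB.
have k := is_derive1_powR mu xt0.
have := @is_derive1_comp _ (fun u : R => u `^ mu) (fun s => x - s) _ _ _ k h.
move=> kh.
have -> : (fun s => - ((x - s) `^ mu / mu)) =
    (- mu^-1) *: ((fun u : R => u `^ mu) \o (fun s => x - s)).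
  by apply/funext => s; rewrite fctE/= scaleNr mulrC.
apply: is_derive_eq; rewrite scaleNr -scalerN /GRing.scale/=.
by rewrite mulrN1 opprK mulrA mulVf ?mul1r// gt_eqF.
Qed.

Lemma measurable_kerl mu x (D : set R) : measurable_fun D (fun t => (x - t) `^ mu).
Proof.
apply: measurable_funTS.
apply: (@measurableT_comp _ _ _ _ _ _ (fun u : R => u `^ mu)) => //.
exact: measurable_funB.
Qed.

(** Stopping short of the singularity at t = x leaves a continuous integrand, to which the
    fundamental theorem applies. *)
Lemma integral_kerl_lt mu c y x : 0 < mu -> c < y -> y < x ->
  (\int[leb]_(t in `[c, y]) ((x - t) `^ (mu - 1))%:E =
   ((x - c) `^ mu / mu - (x - y) `^ mu / mu)%:E)%E.
Proof.
move=> mu0 cy yx.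
pose F s := - ((x - s) `^ mu / mu).
have dF t : t < x -> is_derive t 1 F ((x - t) `^ (mu - 1)).
  exact: is_derive_kerl.
have cF t : t < x -> {for t, continuous F}.
  by move=> tx; apply/differentiable_continuous/derivable1_diffP; have [] := dF _ tx.
rewrite (@continuous_FTC2 _ _ F)//.
- by rewrite /F -EFinB opprK addrC.
- apply: continuous_in_subspaceT => t /set_mem/=; rewrite in_itv/= => /andP[_ ty].
  have tx : 0 < x - t by rewrite subr_gt0 (le_lt_trans ty).
  apply: (@continuous_comp _ _ _ (fun s => x - s) (fun u : R => u `^ (mu - 1))).
    by apply: continuousB; [exact: cvg_cst|exact: cvg_id].
  apply/differentiable_continuous/derivable1_diffP.
  by apply: derivable_powR; rewrite in_itv/= tx.
- split.
  + move=> t; rewrite in_itv/= => /andP[_ ty].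
    by have [] := dF _ (lt_trans ty yx).
  + by apply: cvg_at_right_filter; apply: cF; exact: lt_trans yx.
  + by apply: cvg_at_left_filter; apply: cF.
- move=> t; rewrite in_itv/= => /andP[_ ty]; rewrite derive1E.
  by have [_ ->] := dF _ (lt_trans ty yx).
Qed.

Lemma powR_cvg_seq0 mu (u : R^nat) : 0 < mu -> (forall n, 0 < u n) ->
  u @ \oo --> 0 -> (u n) `^ mu @[n --> \oo] --> 0.
Proof.
move=> mu0 u0 ucv; have /cvg_at_rightP := @powR_cvg0 R _ mu0.
by apply; split.
Qed.

Lemma integral_kerl mu c x : 0 < mu -> c <= x ->
  (\int[leb]_(t in `[c, x]) ((x - t) `^ (mu - 1))%:E =
   ((x - c) `^ mu / mu)%:E)%E.
Proof.
move=> mu0; rewrite le_eqVlt => /predU1P[->|cx].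
  by rewrite set_itv1 integral_set1 subrr powR0 ?gt_eqF// mul0r.
rewrite -integral_itv_bndo_bndc; last first.
  apply/measurable_EFinP.
  exact: measurable_kerl.
(* The intervals [c, x - u n] exhaust [c, x[, and monotone convergence applies. The offset 2 makes u
   n < x - c already at n = 0, so none of them is degenerate. *)
pose u n : R := (x - c) / n.+2%:R.
have u0 n : 0 < u n by rewrite divr_gt0// subr_gt0.
have uc n : u n < x - c by rewrite ltr_pdivrMr// ltr_pMr ?subr_gt0// ltr1n.
have ucv : u @ \oo --> 0.
  rewrite -(mulr0 (x - c)); apply: cvgM; first exact: cvg_cst.
  have := @cvg_harmonic R; rewrite -(cvg_shiftn 1).
  by under eq_fun do rewrite /= addn1.
have -> : `[c, x[%classic = \bigcup_n `[c, x - u n]%classic.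
  apply/seteqP; split => t /=; rewrite in_itv/=.
    move=> /andP[ct tx].
    have /cvgr_lt/(_ (x - t)) : u @ \oo --> (0 : R) by [].
    rewrite subr_gt0 => /(_ tx) [N _ /(_ N (leqnn N)) uN].
    by exists N => //=; rewrite in_itv/= ct/= lerBrDr -lerBrDl ltW.
  move=> [n _ /=]; rewrite in_itv/= => /andP[-> tn]/=.
  by rewrite (le_lt_trans tn)// ltrBlDr ltrDl.
pose I n := (\int[leb]_(t in `[c, (x - u n)%R]) ((x - t) `^ (mu - 1))%:E)%E.
have I1 : I @ \oo -->
    (\int[leb]_(t in \bigcup_n `[c, (x - u n)%R]%classic) ((x - t) `^ (mu - 1))%:E)%E.
  apply: ge0_nondecreasing_set_cvg_integral.
  + apply/nondecreasing_seqP => n.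
    rewrite subsetEset; apply: subset_itvl; rewrite bnd_simp lerB//.
    apply: ler_wpM2l; first by rewrite subr_ge0 ltW.
    by rewrite lef_pV2 ?posrE// ler_nat.
  + by [].
  + by move=> n; apply/measurable_EFinP; exact: measurable_kerl.
  + by move=> n t _; rewrite lee_fin powR_ge0.
have I2 : I @ \oo --> ((x - c) `^ mu / mu)%:E.
  have -> : I =
    (fun n => ((x - c) `^ mu / mu - (u n) `^ mu / mu)%:E).
    apply/funext => n; rewrite /I integral_kerl_lt//; last first.
    + by rewrite ltrBlDr ltrDl.
    + by rewrite ltrBrDr -ltrBrDl.
    by rewrite subKr.
  apply: cvg_EFin; first exact: nearW.
  rewrite -[X in _ --> X]subr0 -[X in _ --> _ - X](mul0r mu^-1).
  apply: cvgB; first exact: cvg_cst.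
  apply: cvgM; last exact: cvg_cst.
  exact: powR_cvg_seq0.
exact: (cvg_unique _ I1 I2).
Qed.



Lemma integrable_kerl mu c x : 0 < mu ->
  leb.-integrable `[c, x] (EFin \o (fun t => (x - t) `^ (mu - 1))).
Proof.
move=> mu0; have [cx|xc] := leP c x; last first.
  by rewrite set_itv_ge ?bnd_simp -?ltNge//; exact: integrable_set0.
apply/integrableP; split.
  by apply/measurable_EFinP; exact: measurable_kerl.
under eq_integral do rewrite gee0_abs ?lee_fin ?powR_ge0//.
by rewrite integral_kerl// ltry.
Qed.

Lemma continuous_bounded_itv f a b : continuous f ->
  [bounded f t | t in `[a, b]].
Proof.
move=> cf; have : compact (f @` `[a, b]).
  apply: continuous_compact; last exact: segment_compact.
  exact: continuous_subspaceT.
by move=> /compact_bounded; rewrite /bounded_set /bounded_near;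
   apply: filterS => M h t tab; apply: h; exists t.
Qed.

(* Unnormalised Riemann-Liouville integrals: [rl_intl a mu f x] is
   [(Gamma mu)^-1 * Il a mu f x], and likewise for [rl_intr] and [Ir]. *)
Definition Il a mu f x := \int[leb]_(t in `[a, x]) ((x - t) `^ (mu - 1) * f t).
Definition Ir b mu f x := \int[leb]_(t in `[x, b]) ((t - x) `^ (mu - 1) * f t).

Lemma integrable_Il a mu f x : 0 < mu -> continuous f ->
  leb.-integrable `[a, x] (EFin \o (fun t => (x - t) `^ (mu - 1) * f t)).
Proof.
move=> mu0 cf.
have := @integrableMl _ (measurableTypeR R) R leb `[a, x]%classic _ (EFin \o _) f (integrable_kerl a x mu0).
apply => //.
- by apply: measurable_funTS; exact: continuous_measurable_fun.
- exact: continuous_bounded_itv.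
Qed.


(** Reflection carries results on left integrals over to right ones. Positive and negative parts are
    transported separately through the image measure, so the identity may be used before
    integrability is known. *)
Lemma integral_itv_opp (f : measurableTypeR R -> \bar R) a b :
  measurable_fun setT f ->
  (\int[leb]_(t in `[a, b]) f t = \int[leb]_(t in `[(- b)%R, (- a)%R]) f (- t)%R)%E.
Proof.
have ge0 (g : measurableTypeR R -> \bar R) : measurable_fun setT g ->
    (forall t, 0 <= g t)%E ->
  (\int[leb]_(t in `[a, b]) g t = \int[leb]_(t in `[(- b)%R, (- a)%R]) g (- t)%R)%E.
  move=> mg g0.
  have -> : `[- b, - a]%classic = (-%R : _ -> measurableTypeR R) @^-1` `[a, b].
    by rewrite opp_preimage_itvbndbnd.
  rewrite -ge0_integral_pushforward//=; last exact: measurable_funTS.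
  by apply: eq_measure_integral => //= A mA _; exact/esym/lebesgue_measureN.
move=> mf; rewrite integralE [RHS]integralE; congr (_ - _)%E.
- have h : (forall t : measurableTypeR R, 0 <= f^\+ t)%E by move=> t; exact: funepos_ge0.
  have k : measurable_fun setT f^\+%E by exact: measurable_funepos mf.
  by rewrite (ge0 _ k h); apply: eq_integral => t _; rewrite ?funeposE ?funenegE.
- have h : (forall t : measurableTypeR R, 0 <= f^\- t)%E by move=> t; exact: funeneg_ge0.
  have k : measurable_fun setT f^\-%E by exact: measurable_funeneg mf.
  by rewrite (ge0 _ k h); apply: eq_integral => t _; rewrite ?funeposE ?funenegE.
Qed.

Lemma integrable_itv_opp (f : measurableTypeR R -> \bar R) a b :
  measurable_fun setT f ->
  leb.-integrable `[- b, - a] (fun t => f (- t)) -> leb.-integrable `[a, b] f.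
Proof.
move=> mf /integrableP[_ ioo]; apply/integrableP; split.
  exact: measurable_funTS.
by rewrite integral_itv_opp//; exact: measurableT_comp.
Qed.

Lemma measurable_Ir mu x f : continuous f ->
  measurable_fun setT (fun t : R => (t - x) `^ (mu - 1) * f t).
Proof.
move=> cf; apply: measurable_funM.
  apply: (@measurableT_comp _ _ _ _ _ _ (fun u : R => u `^ (mu - 1))) => //.
  exact: measurable_funB.
exact: continuous_measurable_fun.
Qed.

Lemma continuous_compN f : continuous f -> continuous (fun t => f (- t)).
Proof. by move=> cf t; apply: continuous_comp; [exact: opp_continuous|exact: cf]. Qed.

Lemma Ir_Il b mu f x : continuous f ->
  Ir b mu f x = Il (- b) mu (fun t => f (- t)) (- x).
Proof.
move=> cf; rewrite /Ir /Il /Rintegral integral_itv_opp; last first.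
  by apply/measurable_EFinP; exact: measurable_Ir.
by congr fine; apply: eq_integral => t _; rewrite (addrC (- x)) .
Qed.

Lemma integrable_Ir b mu f x : 0 < mu -> continuous f ->
  leb.-integrable `[x, b] (EFin \o (fun t => (t - x) `^ (mu - 1) * f t)).
Proof.
move=> mu0 cf; apply: integrable_itv_opp.
  by apply/measurable_EFinP; exact: measurable_Ir.
have := integrable_Il (- b) (- x) mu0 (continuous_compN cf).
by apply: eq_integrable => // t _ /=; rewrite (addrC (- x)).
Qed.

Lemma Rintegral_kerl mu c x : 0 < mu -> c <= x ->
  \int[leb]_(t in `[c, x]) ((x - t) `^ (mu - 1)) = (x - c) `^ mu / mu.
Proof. by move=> mu0 cx; rewrite /Rintegral integral_kerl. Qed.

Lemma Rintegral_itv_split f a x y : a <= x -> x <= y ->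
  leb.-integrable `[a, y] (EFin \o f) ->
  \int[leb]_(t in `[a, y]) f t =
  \int[leb]_(t in `[a, x]) f t + \int[leb]_(t in `[x, y]) f t.
Proof.
move=> ax xy fi.
have := @Rintegral_itvB R f (BLeft a) (BRight y) x fi.
rewrite !bnd_simp => /(_ ax xy); rewrite Rintegral_itv_obnd_cbnd => [<-|].
  by rewrite addrC subrK.
apply: integrableS fi => //; apply: subset_itvr; rewrite bnd_simp; exact: ax.
Qed.

Lemma Rintegral_kerl_part mu a x y : 0 < mu -> a <= x -> x <= y ->
  \int[leb]_(t in `[a, x]) ((y - t) `^ (mu - 1)) =
  ((y - a) `^ mu - (y - x) `^ mu) / mu.
Proof.
move=> mu0 ax xy.
have := Rintegral_itv_split ax xy (integrable_kerl a y mu0).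
rewrite !Rintegral_kerl// ?(le_trans ax)// => h.
by rewrite mulrBl h addrK.
Qed.

End Kernel.

(** * Hoelder continuity and linearity of fractional integrals *)

Section KernelHoelder.
Context {R : realType}.
Notation leb := (@lebesgue_measure R).
Implicit Types (a b c d x y mu : R) (f g : R -> R).

Lemma ler_norm_Rintegral_kerl (k f : R -> R) (M : R) (D : set (measurableTypeR R)) :
  measurable D ->
  leb.-integrable D (EFin \o k) -> leb.-integrable D (EFin \o (fun t => k t * f t)) ->
  (forall t, D t -> 0 <= k t) -> (forall t, D t -> `|f t| <= M) ->
  `|\int[leb]_(t in D) (k t * f t)| <= M * \int[leb]_(t in D) k t.
Proof.
move=> mD ik ikf k0 fM.
apply: (le_trans (le_normr_Rintegral mD ikf)).
rewrite -RintegralZl//; apply: le_Rintegral => //.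
- by have := integrable_norm ikf; apply: eq_integrable.
- have := @integrableZl _ _ _ leb D mD M _ ik; apply: eq_integrable => //.
- by move=> t Dt; rewrite normrM ger0_norm ?k0// mulrC ler_wpM2r ?k0 ?fM.
Qed.

Lemma ler_powR_neg mu (u v : R) : mu <= 1 -> 0 < u -> u <= v ->
  v `^ (mu - 1) <= u `^ (mu - 1).
Proof.
move=> mu1 u0 uv; have v0 := lt_le_trans u0 uv.
have e w : w `^ (mu - 1) = (w `^ (1 - mu))^-1 by rewrite -powRN opprB.
rewrite !e lef_pV2 ?posrE ?powR_gt0//.
by apply: ge0_ler_powR; rewrite ?nnegrE ?subr_ge0// ltW.
Qed.

(** The difference is the integral of (y - t)^(mu - 1) f over [x, y] minus that of ((x - t)^(mu - 1)
    - (y - t)^(mu - 1)) f over [a, x]. The latter kernel is nonnegative since mu <= 1, with integral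
    ((x - a)^mu - (y - a)^mu + (y - x)^mu) / mu, at most (y - x)^mu / mu; the former kernel has
    exactly that integral, hence the factor 2. *)
Lemma Il_hoelder a mu f x y (M : R) : 0 < mu -> mu <= 1 -> continuous f ->
  a <= x -> x <= y -> (forall t, t \in `[a, y] -> `|f t| <= M) ->
  `|Il a mu f y - Il a mu f x| <= 2 * M / mu * (y - x) `^ mu.
Proof.
move=> mu0 mu1 cf ax xy fM.
have M0 : 0 <= M.
  by apply: le_trans (fM a _); rewrite ?normr_ge0// in_itv/= lexx (le_trans ax).
have iy := integrable_Il a y mu0 cf.
(* The endpoint [t = x] is excluded because the junk value [0 `^ (mu - 1) = 0]
   breaks the monotonicity of the kernel there. *)
have sub : `[a, x[ `<=` `[a, y].
  by apply: subset_itvl; rewrite bnd_simp.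
have subx : `[a, x[ `<=` `[a, x].
  by apply: subset_itvl; rewrite bnd_simp.
have iyx : leb.-integrable `[a, x[ (EFin \o (fun t => (y - t) `^ (mu - 1) * f t)).
  exact: integrableS iy.
have ix : leb.-integrable `[a, x[ (EFin \o (fun t => (x - t) `^ (mu - 1) * f t)).
  by apply: integrableS (integrable_Il a x mu0 cf).
have ky : leb.-integrable `[a, x[ (EFin \o (fun t => (y - t) `^ (mu - 1))).
  by apply: integrableS (integrable_kerl a y mu0).
have kx : leb.-integrable `[a, x[ (EFin \o (fun t => (x - t) `^ (mu - 1))).
  by apply: integrableS (integrable_kerl a x mu0).
rewrite /Il (Rintegral_itv_split ax xy iy).
rewrite addrAC -[X in X - _ + _]Rintegral_itv_bndo_bndc//.
rewrite -[X in _ - X + _]Rintegral_itv_bndo_bndc// -opprB -RintegralB//.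
set A := Rintegral _ _ _; set B := Rintegral _ _ _.
have -> : 2 * M / mu * (y - x) `^ mu =
  M * ((y - x) `^ mu / mu) + M * ((y - x) `^ mu / mu) by field; rewrite gt_eqF.
apply: (le_trans (ler_normD _ _)); apply: lerD; last first.
  rewrite -Rintegral_kerl//; apply: ler_norm_Rintegral_kerl => //.
  - exact: integrable_kerl.
  - exact: integrable_Il.
  - by move=> t _; exact: powR_ge0.
  - move=> t /=; rewrite in_itv/= => /andP[xt ty]; apply: fM.
    by rewrite in_itv/= ty (le_trans ax).
rewrite normrN /A.
under eq_Rintegral do rewrite -mulrBl.
have ikB : leb.-integrable `[a, x[ (EFin \o (fun t => (x - t) `^ (mu - 1) - (y - t) `^ (mu - 1))).
  have := integrableB _ kx ky; apply => //.
apply: (le_trans (ler_norm_Rintegral_kerl (M := M) _ _ _ _ _)) => //.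
- have := integrableB _ ix iyx => /(_ _) h.
  by apply: eq_integrable (h _) => // t _ /=; rewrite mulrBl.
- move=> t /=; rewrite in_itv/= => /andP[_ tx].
  have xt0 : 0 < x - t by rewrite subr_gt0.
  have xyt : x - t <= y - t by rewrite lerB.
  by rewrite subr_ge0; exact: ler_powR_neg.
- move=> t /=; rewrite in_itv/= => /andP[at_ tx]; apply: fM.
  by rewrite in_itv/= at_/= (le_trans (ltW tx)).
- rewrite ler_wpM2l// RintegralB// !Rintegral_itv_bndo_bndc//.
  rewrite Rintegral_kerl// Rintegral_kerl_part// -mulrBl.
  apply: ler_wpM2r; first by rewrite invr_ge0 ltW.
  have : (x - a) `^ mu <= (y - a) `^ mu.
    have ay := le_trans ax xy.
    by apply: ge0_ler_powR; rewrite ?nnegrE ?subr_ge0 ?lerB//; exact: ltW.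
  by lra.
Qed.


Lemma hoelder_continuous (F : R -> R) (C : R) a b mu : 0 < mu ->
  (forall x y, a <= x -> x <= y -> y <= b -> `|F y - F x| <= C * (y - x) `^ mu) ->
  {within `[a, b], continuous F}.
Proof.
move=> mu0 FC; apply/subspace_continuousP => x /=.
rewrite in_itv/= => /andP[ax xb]; apply/cvgrPdist_lt => e e0.
have H y : a <= y -> y <= b -> `|F x - F y| <= C * `|x - y| `^ mu.
  move=> ay yb; have [xy|/ltW yx] := leP x y.
    by rewrite [leLHS]distrC (distrC x) (@ger0_norm _ (y - x)) ?subr_ge0//; exact: FC.
  by rewrite (@ger0_norm _ (x - y)) ?subr_ge0//; exact: FC.
(* Chosen so that (|C| + 1) d^mu = e; the added 1 keeps the denominator positive when C = 0. *)
pose d := (e / (`|C| + 1)) `^ mu^-1.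
have C0 : 0 < `|C| + 1 by rewrite ltr_wpDl.
have d0 : 0 < d by rewrite powR_gt0// divr_gt0.
have : nbhs x (ball x d) by exact: nbhsx_ballx.
apply: filterS => y xy /=; rewrite in_itv/= => /andP[ay yb].
apply: (le_lt_trans (H y ay yb)).
have h : `|x - y| `^ mu < e / (`|C| + 1).
  have -> : e / (`|C| + 1) = d `^ mu.
    by rewrite /d -powRrM mulVf ?gt_eqF// powRr1// ltW// divr_gt0.
  by apply: gt0_ltr_powR => //; rewrite nnegrE//; exact: ltW.
apply: (@le_lt_trans _ _ (`|C| * `|x - y| `^ mu)).
  by rewrite ler_wpM2r ?powR_ge0// ler_norm.
apply: (@le_lt_trans _ _ ((`|C| + 1) * `|x - y| `^ mu)).
  by rewrite ler_wpM2r ?powR_ge0// lerDl.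
by rewrite mulrC -ltr_pdivlMr.
Qed.

Lemma Il_continuous a b mu f : 0 < mu -> mu <= 1 -> continuous f ->
  {within `[a, b], continuous (Il a mu f)}.
Proof.
move=> mu0 mu1 cf.
(* Boundedness provides every number above M as a bound, hence M + 1. *)
have [M [_ MP]] := continuous_bounded_itv a b cf.
have fM t : t \in `[a, b] -> `|f t| <= M + 1 by apply: MP; rewrite ltrDl.
apply: (@hoelder_continuous _ (2 * (M + 1) / mu) _ _ mu) => // x y ax xy yb.
apply: Il_hoelder => // t; rewrite in_itv/= => /andP[at_ ty].
by apply: fM; rewrite in_itv/= at_ (le_trans ty).
Qed.

Lemma Ir_continuous a b mu f : 0 < mu -> mu <= 1 -> continuous f ->
  {within `[a, b], continuous (Ir b mu f)}.
Proof.
move=> mu0 mu1 cf.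
have -> : Ir b mu f = Il (- b) mu (fun t => f (- t)) \o -%R.
  by apply/funext => x; rewrite Ir_Il.
by apply: within_continuous_compN; apply: Il_continuous => //; exact: continuous_compN.
Qed.

Lemma IlDZ a mu f g k x : 0 < mu -> continuous f -> continuous g ->
  Il a mu (fun t => f t + k * g t) x = Il a mu f x + k * Il a mu g x.
Proof.
move=> mu0 cf cg; rewrite /Il -RintegralZl//; last exact: integrable_Il.
rewrite -RintegralD//; last 2 first.
- exact: integrable_Il.
- have := @integrableZl _ _ _ leb _ _ k _ (integrable_Il a x mu0 cg).
  by move=> /(_ (measurable_itv _)); apply: eq_integrable.
by apply: eq_Rintegral => t _; ring.
Qed.

Lemma IrDZ b mu f g k x : 0 < mu -> continuous f -> continuous g ->
  Ir b mu (fun t => f t + k * g t) x = Ir b mu f x + k * Ir b mu g x.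
Proof.
move=> mu0 cf cg; rewrite !Ir_Il//; last first.
  move=> t; apply: cvgD; first exact: cf.
  by apply: cvgM; [exact: cvg_cst|exact: cg].
by rewrite (@IlDZ _ _ (fun t => f (- t)) (fun t => g (- t)))//; exact: continuous_compN.
Qed.

(** Fractional integrals on [a, b] see only the values there, so a function may be replaced by its
    clamped extension, to which the lemmas on continuous functions apply. *)
Lemma eq_Il a b mu f g x : x \in `[a, b] -> {in `[a, b], f =1 g} ->
  Il a mu f x = Il a mu g x.
Proof.
rewrite in_itv/= => /andP[ax xb] fg; apply: eq_Rintegral => t.
rewrite inE/= in_itv/= => /andP[at_ tx].
by rewrite fg// in_itv/= at_ (le_trans tx).
Qed.

Lemma eq_Ir a b mu f g x : x \in `[a, b] -> {in `[a, b], f =1 g} ->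
  Ir b mu f x = Ir b mu g x.
Proof.
rewrite in_itv/= => /andP[ax xb] fg; apply: eq_Rintegral => t.
rewrite inE/= in_itv/= => /andP[xt tb].
by rewrite fg// in_itv/= tb (le_trans ax).
Qed.

End KernelHoelder.

(** * Fractional integration by parts *)

Section Fubini.
Context {R : realType}.
Notation leb := (@lebesgue_measure R).
Notation mR := (measurableTypeR R).
Implicit Types (a b c d x y mu : R) (f g : R -> R).

Let triangle a b (z : mR * mR) := [&& a <= z.2, z.2 <= z.1 & z.1 <= b].

(** The first coordinate is x, the second t. Extension by 0 outside the triangle lets both iterated
    integrals run over the whole line, as in Fubini's theorem. *)
Let kernel2 a b mu f g (z : mR * mR) : R :=
  if triangle a b z then (z.1 - z.2) `^ (mu - 1) * (g z.1 * f z.2) else 0.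

Let measurable_kernel2 a b mu f g : continuous f -> continuous g ->
  measurable_fun setT (kernel2 a b mu f g).
Proof.
move=> cf cg; apply: measurable_fun_ifT => //.
  apply: measurable_and; last apply: measurable_and.
  - by apply: measurable_fun_ler.
  - by apply: measurable_fun_ler.
  - by apply: measurable_fun_ler.
apply: measurable_funM.
  apply: (@measurableT_comp _ _ _ _ _ _ (fun u : R => u `^ (mu - 1))) => //.
  by apply: measurable_funB; [exact: measurable_fst|exact: measurable_snd].
apply: measurable_funM.
  apply: (@measurableT_comp _ _ _ _ _ _ g); last exact: measurable_fst.
  exact: continuous_measurable_fun.
apply: (@measurableT_comp _ _ _ _ _ _ f); last exact: measurable_snd.
exact: continuous_measurable_fun.
Qed.

(** [F] is [abse] for the integrability bound and [idfun] for the exchange of integrals; F 0 = 0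
    preserves the vanishing outside the triangle. *)
Let sectionl a b mu f g (F : \bar R -> \bar R) x : F 0%E = 0%E ->
  (\int[leb]_t F (kernel2 a b mu f g (x, t))%:E =
   if x \in `[a, b] then
     \int[leb]_(t in `[a, x]) F ((x - t) `^ (mu - 1) * (g x * f t))%:E
   else 0)%E.
Proof.
move=> F0; case: ifPn => [|xab].
  rewrite in_itv/= => /andP[ax xb].
  rewrite [RHS]integral_mkcond; apply: eq_integral => t _.
  rewrite patchE/= /kernel2 /triangle/= xb andbT.
  have -> : (t \in `[a, x]%classic) = (a <= t <= x).
    by apply/idP/idP; rewrite inE/= in_itv.
  by case: ifP => // _; rewrite F0.
apply: integral0_eq => t _.
rewrite /kernel2 /triangle/=; case: ifPn => // /and3P[at_ tx xb].
by case/negP: xab; rewrite in_itv/= xb (le_trans at_).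
Qed.

Let sectionr a b mu f g (F : \bar R -> \bar R) t : F 0%E = 0%E ->
  (\int[leb]_x F (kernel2 a b mu f g (x, t))%:E =
   if t \in `[a, b] then
     \int[leb]_(x in `[t, b]) F ((x - t) `^ (mu - 1) * (g x * f t))%:E
   else 0)%E.
Proof.
move=> F0; case: ifPn => [|tab].
  rewrite in_itv/= => /andP[at_ tb].
  rewrite [RHS]integral_mkcond; apply: eq_integral => x _.
  rewrite patchE/= /kernel2 /triangle/= at_/=.
  have -> : (x \in `[t, b]%classic) = (t <= x <= b).
    by apply/idP/idP; rewrite inE/= in_itv.
  by case: ifP => // _; rewrite F0.
apply: integral0_eq => x _.
rewrite /kernel2 /triangle/=; case: ifPn => // /and3P[at_ tx xb].
by case/negP: tab; rewrite in_itv/= at_ (le_trans tx).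
Qed.

Let integrable_kernel2 a b mu f g : 0 < mu -> continuous f -> continuous g ->
  (leb \x leb)%E.-integrable setT (EFin \o kernel2 a b mu f g).
Proof.
move=> mu0 cf cg.
have mK : measurable_fun setT (EFin \o kernel2 a b mu f g).
  by apply/measurable_EFinP; exact: measurable_kernel2.
apply/(@integrable12ltyP _ _ mR mR R leb leb _ mK).
have [M [_ MP]] := continuous_bounded_itv a b cf.
have fM t : t \in `[a, b] -> `|f t| <= `|M| + 1.
  by apply: MP; rewrite (le_lt_trans (ler_norm _))// ltrDl.
have [M' [_ MP']] := continuous_bounded_itv a b cg.
have gM t : t \in `[a, b] -> `|g t| <= `|M'| + 1.
  by apply: MP'; rewrite (le_lt_trans (ler_norm _))// ltrDl.
(* Bounds the inner integral of the absolute value for every x in [a, b]: bounds of f and g times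
   the integral of the kernel, which is largest at x = b. *)
pose C := (`|M| + 1) * (`|M'| + 1) * ((b - a) `^ mu / mu).
have C0 : 0 <= C by rewrite !mulr_ge0 ?addr_ge0// ?powR_ge0// invr_ge0 ltW.
apply: (@le_lt_trans _ _ (\int[leb]_(x in `[a, b]) (cst C%:E) x)%E); last first.
  rewrite integral_cst//= lebesgue_measure_itv/=.
  by case: ifPn => _; rewrite ?mule0 ?ltry// -EFinD -EFinM ltry.
rewrite [leRHS]integral_mkcond; apply: ge0_le_integral => //.
- by move=> x _; exact: integral_ge0.
- apply: (@measurable_fun_fubini_tonelli_F _ _ _ _ _ _ (abse \o (EFin \o kernel2 a b mu f g))) => //.
  + exact: measurableT_comp.
  + by move=> z; exact: abse_ge0.
- by apply/(measurable_restrictT (cst C%:E)).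
move=> x _; rewrite /= (@sectionl _ _ _ _ _ (@abse R) _ (@abse0 R)) patchE.
have -> : (x \in `[a, b]%classic) = (x \in `[a, b]) by rewrite mem_setE.
case: ifPn => // xab; have := xab; rewrite in_itv/= => /andP[ax xb].
apply: (@le_trans _ _ (\int[leb]_(t in `[a, x])
    (((`|M| + 1) * (`|M'| + 1))%:E * ((x - t) `^ (mu - 1))%:E))%E).
  apply: ge0_le_integral => //.
  - apply: measurableT_comp => //; apply: measurableT_comp => //.
    apply: measurable_funM; first exact: measurable_kerl.
    apply: measurable_funM => //.
    by apply: measurable_funTS; exact: continuous_measurable_fun.
  - apply: measurable_funeM; apply: measurableT_comp => //; exact: measurable_kerl.
  - move=> t /=; rewrite in_itv/= => /andP[at_ tx].
    rewrite -EFinM lee_fin mulrC normrM [X in _ * X]ger0_norm ?powR_ge0//.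
    rewrite ler_wpM2r ?powR_ge0// normrM mulrC ler_pM ?gM ?fM//.
    by rewrite in_itv/= at_ (le_trans tx).
rewrite ge0_integralZl//.
- rewrite integral_kerl// -EFinM lee_fin ler_wpM2l ?mulr_ge0 ?addr_ge0//.
  apply: ler_wpM2r; first by rewrite invr_ge0 ltW.
  have ab := le_trans ax xb.
  by apply: ge0_ler_powR; rewrite ?nnegrE ?subr_ge0 ?lerB//; exact: ltW.
- by apply/measurable_EFinP; exact: measurable_kerl.
- by move=> t _; rewrite lee_fin powR_ge0.
Qed.

(* The case [mu = 1] is integration by parts. *)
Lemma fractional_integration_by_parts a b mu f g :
  0 < mu -> continuous f -> continuous g ->
  \int[leb]_(x in `[a, b]) (g x * Il a mu f x) =
  \int[leb]_(t in `[a, b]) (f t * Ir b mu g t).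
Proof.
move=> mu0 cf cg.
have := @Fubini _ _ mR mR R leb leb (EFin \o kernel2 a b mu f g)
  (integrable_kernel2 a b mu0 cf cg).
rewrite /= => FE; rewrite /Rintegral; congr fine.
rewrite integral_mkcond [RHS]integral_mkcond.
transitivity (\int[leb]_x \int[leb]_t (kernel2 a b mu f g (x, t))%:E)%E.
  apply: eq_integral => x _; rewrite (@sectionl _ _ _ _ _ idfun _ erefl)// patchE.
  have -> : (x \in `[a, b]%classic) = (x \in `[a, b]) by rewrite mem_setE.
  case: ifPn => // xab.
  (* [Il] is the finite part of the inner integral; integrability shows that taking it loses
     nothing. *)
  have iI := integrable_Il a x mu0 cf.
  rewrite /Il -RintegralZl// /Rintegral fineK.
    by apply: eq_integral => t _; congr EFin; ring.
  apply: integrable_fin_num => //.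
  have := @integrableZl _ _ _ leb _ (measurable_itv _) (g x) _ iI.
  by apply: eq_integrable.
rewrite FE; apply: eq_integral => t _; rewrite (@sectionr _ _ _ _ _ idfun _ erefl)// patchE.
have -> : (t \in `[a, b]%classic) = (t \in `[a, b]) by rewrite mem_setE.
case: ifPn => // tab.
have iI := integrable_Ir b t mu0 cg.
rewrite /Ir -RintegralZl// /Rintegral fineK.
  by apply: eq_integral => x _; congr EFin; ring.
apply: integrable_fin_num => //.
have := @integrableZl _ _ _ leb _ (measurable_itv _) (f t) _ iI.
by apply: eq_integrable.
Qed.

End Fubini.

(** * Clamping and the fundamental theorem of calculus *)

Section Clamp.
Context {R : realType}.
Implicit Types (a b x : R).

Lemma continuous_within_comp (T U V : topologicalType) (A : set U)
    (f : U -> V) (g : T -> U) :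
  {within A, continuous f} -> continuous g -> (forall t, A (g t)) ->
  continuous (f \o g).
Proof.
move=> /subspace_continuousP cf cg gA t.
apply: (@cvg_comp _ _ _ g f _ (within A (nbhs (g t)))); last exact: cf.
move=> B AB; have h : \forall s \near t, A (g s) -> B (g s) := cg t _ AB.
by apply: filterS h => s; apply; exact: gA.
Qed.

(* Precomposing with [clamp a b] turns continuity within [`[a, b]] into global
   continuity without changing the values on [`[a, b]]. *)
Definition clamp a b x : R := Num.min (Num.max x a) b.

Lemma continuous_clamp a b : continuous (clamp a b).
Proof.
move=> x; apply: (@continuous_min _ _ (fun x => Num.max x a) (fun=> b)).
  by apply: (@continuous_max _ _ id (fun=> a)); [exact: cvg_id|exact: cvg_cst].
exact: cvg_cst.
Qed.

Lemma clamp_itv a b x : a <= b -> clamp a b x \in `[a, b].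
Proof. by move=> ab; rewrite in_itv/= /clamp le_min ab andbT le_max lexx orbT/= ge_min lexx orbT. Qed.

Lemma clamp_id a b x : x \in `[a, b] -> clamp a b x = x.
Proof.
by rewrite in_itv/= => /andP[ax xb]; rewrite /clamp (max_idPl ax) (min_idPl xb).
Qed.

Lemma continuous_clamp_comp (V : topologicalType) (f : R -> V) a b : a <= b ->
  {within `[a, b], continuous f} -> continuous (f \o clamp a b).
Proof.
move=> ab cf; apply: (continuous_within_comp cf); first exact: continuous_clamp.
by move=> t; exact: clamp_itv.
Qed.

Lemma eq_within_continuous (T V : topologicalType) (A : set T) (f g : T -> V) :
  (forall t, A t -> f t = g t) ->
  {within A, continuous f} -> {within A, continuous g}.
Proof.
move=> fg; apply: subspace_eq_continuous => x /set_mem; exact: fg.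
Qed.

End Clamp.

Section FTC.
Context {R : realType} (a b : R).
Hypothesis ab : a < b.
Notation leb := (@lebesgue_measure R).
Implicit Types (f : R -> R) (x : R).

Lemma continuous_integrable f c d : continuous f ->
  leb.-integrable `[c, d] (EFin \o f).
Proof.
move=> cf; apply: continuous_compact_integrable; first exact: segment_compact.
exact: continuous_subspaceT.
Qed.

(** At t = x the kernel is 0 to the power 0, which is 1, so order 1 has no exceptional endpoint. *)
Lemma Il1E c f x : Il c 1 f x = \int[leb]_(t in `[c, x]) f t.
Proof. by apply: eq_Rintegral => t _; rewrite subrr powRr0 mul1r. Qed.

Lemma Ir1E c f x : Ir c 1 f x = \int[leb]_(t in `[x, c]) f t.
Proof. by apply: eq_Rintegral => t _; rewrite subrr powRr0 mul1r. Qed.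

Lemma Il1_has_deriv_on f x : continuous f -> x \in `[a, b] ->
  has_deriv_on (a := a) (b := b) (Il a 1 f) x (f x).
Proof.
move=> cf xab; have := xab; rewrite in_itv/= => /andP[ax xb].
(* The lower limit a - 1 puts every x of [a, b], a included, strictly inside, so the two-sided
   theorem applies; subtracting F a restores the base point. *)
pose F y := \int[leb]_(t in `[a - 1, y]) f t.
have := @continuous_FTC1_closed R f (a - 1) x (x + 1).
rewrite ltrDl ltr01 => /(_ isT (continuous_integrable _ _ cf)).
have -> : a - 1 < x by rewrite (lt_le_trans _ ax)// ltrBlDr ltrDl.
move=> /(_ isT (cf x)) [dF F'].
have h := derivable_has_deriv_on (a := a) (b := b) dF.
rewrite F' in h.
apply: (@has_deriv_on_eq _ _ _ (fun y => F y + (-1) * F a)) => //.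
  move=> y; rewrite in_itv/= => /andP[ay yb].
  rewrite Il1E /F mulN1r (@Rintegral_itv_split _ f (a - 1) a y)//.
  - by rewrite addrAC subrr add0r.
  - by rewrite lerBlDr lerDl.
  - exact: continuous_integrable.
rewrite -[f x]addr0 -[X in _ + X](mulr0 (-1)).
by apply: has_deriv_onDZ => //; exact: has_deriv_on_cst.
Qed.

Lemma Ir1_has_deriv_on f x : continuous f -> x \in `[a, b] ->
  has_deriv_on (a := a) (b := b) (Ir b 1 f) x (- f x).
Proof.
move=> cf xab.
apply: (@has_deriv_on_eq _ _ _ (fun y => Il a 1 f b + (-1) * Il a 1 f y)) => //.
  move=> y; rewrite in_itv/= => /andP[ay yb].
  rewrite Ir1E !Il1E (Rintegral_itv_split ay yb); first by rewrite mulN1r addrAC subrr add0r.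
  exact: continuous_integrable.
have := has_deriv_onDZ (k := -1) (has_deriv_on_cst (a := a) (b := b) x (Il a 1 f b))
  (Il1_has_deriv_on cf xab).
by rewrite add0r mulN1r.
Qed.

(** The primitive of f^2 from a lies between 0 and the total integral, hence is 0 on [a, b]; so its
    derivative f^2 vanishes, at the endpoints as well. *)
Lemma Rintegral_sqr_eq0 f : continuous f ->
  \int[leb]_(x in `[a, b]) (f x ^+ 2) <= 0 -> {in `[a, b], forall x, f x = 0}.
Proof.
move=> cf f0 x xab.
have cf2 : continuous (fun x => f x ^+ 2).
  by move=> y; apply: cvgM; exact: cf.
pose F := Il a 1 (fun x => f x ^+ 2).
have F0 y : y \in `[a, b] -> F y = 0.
  rewrite in_itv/= => /andP[ay yb]; apply/eqP; rewrite eq_le.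
  rewrite {2}/F Il1E Rintegral_ge0 ?andbT; last by move=> t _; exact: sqr_ge0.
  apply: le_trans f0; rewrite (Rintegral_itv_split ay yb).
    by rewrite /F Il1E lerDl; apply: Rintegral_ge0 => t _; exact: sqr_ge0.
  exact: continuous_integrable.
have h := Il1_has_deriv_on cf2 xab.
have k : has_deriv_on (a := a) (b := b) F x 0.
  apply: (@has_deriv_on_eq _ _ _ (fun=> 0)) => //; last exact: has_deriv_on_cst.
  by move=> y yab; rewrite F0.
have [_ e1] := has_deriv_onP ab xab h.
have [_ e2] := has_deriv_onP ab xab k.
by apply/eqP; rewrite -sqrf_eq0 -e1 e2.
Qed.

End FTC.

(** * Directional derivatives of the Lagrangian and the first variation *)

Section SlabCalculus.
Context {R : realType} {N : nat} (a b : R).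
Local Notation W := (R * 'rV[R]_N * 'rV[R]_N * 'rV[R]_N)%type.
Implicit Types (L : W -> R) (p q u v e : W).

(** The directions that keep time fixed. A line in such a direction never leaves the slab, so
    two-sided derivatives along it make sense even where time is a or b. *)
Definition horizontal e := e.1.1.1 = 0.

Lemma slabD p e (t : R) : horizontal e -> slab a b p -> slab a b (p + t *: e).
Proof.
by rewrite /horizontal /slab/= => -> pab; rewrite scaler0 addr0.
Qed.

Lemma is_derive_line L p e (t : R) : derivable L (p + t *: e) e ->
  is_derive t 1 (fun s => L (p + s *: e)) ('D_e L (p + t *: e)).
Proof.
have E : (fun h => h^-1 *: (((fun s => L (p + s *: e)) \o shift t) (h *: 1)
                            - L (p + t *: e))) =
    (fun h => h^-1 *: ((L \o shift (p + t *: e)) (h *: e) - L (p + t *: e))).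
  apply/funext => h /=; congr (_ *: (L _ - _)).
  by rewrite [h *: 1]mulr1 scalerDl addrCA.
move=> dL; apply: DeriveDef; first by rewrite /derivable E.
by rewrite /derive E.
Qed.

Lemma slab_mvt L p e (s : R) : slab a b p -> horizontal e ->
  (forall q, slab a b q -> derivable L q e) ->
  exists t : R, `|t| <= `|s| /\
    L (p + s *: e) - L p = s * 'D_e L (p + t *: e).
Proof.
move=> pab e0 dL.
pose phi (t : R) := L (p + t *: e).
have dphi (t : R) : is_derive t 1 phi ('D_e L (p + t *: e)).
  by apply: is_derive_line; apply: dL; exact: slabD.
have cphi (A : set R) : {within A, continuous phi}.
  apply: continuous_subspaceT => t.
  by apply/differentiable_continuous/derivable1_diffP; have [] := dphi t.
have phi0 : phi 0 = L p by rewrite /phi scale0r addr0.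
have [s0|/ltW s0] := leP 0 s.
  have [t + E] := MVT_segment s0 (fun x _ => dphi x) (cphi _).
  rewrite in_itv/= => /andP[t0 ts]; exists t; split.
    by rewrite !ger0_norm.
  by rewrite -phi0 -/(phi s) E subr0 mulrC.
have [t + E] := MVT_segment s0 (fun x _ => dphi x) (cphi _).
rewrite in_itv/= => /andP[ts t0]; exists t; split.
  by rewrite !ler0_norm// lerN2.
by rewrite -phi0 -/(phi s) -opprB E sub0r mulrN opprK mulrC.
Qed.

Lemma cvg_is_derive L p e (l : R) :
  h^-1 *: (L (h *: e + p) - L p) @[h --> 0^'] --> l -> is_derive p e L l.
Proof.
move=> h; apply: DeriveDef; first by apply/cvg_ex; exists l.
exact: (cvg_lim (@Rhausdorff R)).
Qed.

(* Only the second directional derivative has to be continuous: it is the one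
   to which the mean value theorem is applied. *)
Lemma is_deriveDZ L p u v (du s : R) : slab a b p ->
  horizontal u -> horizontal v -> is_derive p u L du ->
  (forall q, slab a b q -> derivable L q v) ->
  {within slab a b, continuous (fun q => 'D_v L q)} ->
  is_derive p (u + s *: v) L (du + s * 'D_v L p).
Proof.
move=> pab u0 v0 [dLu Eu] dLv cDv; apply: cvg_is_derive.
(* The increment along u + s v splits into one along u and one of length h s along v. The mean value
   theorem turns the latter into h s times a derivative at an intermediate point, which tends to p
   because |th h| <= |h s|. *)
have /choice[th thP] : forall h : R, exists t : R, `|t| <= `|h * s| /\
    L (p + h *: u + (h * s) *: v) - L (p + h *: u) =
    (h * s) * 'D_v L (p + h *: u + t *: v).
  by move=> h; apply: slab_mvt => //; exact: slabD.
have th0 : th h @[h --> 0^'] --> 0.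
  have c : `|h * s| @[h --> 0^'] --> 0.
    rewrite -[X in _ --> X](normr0 R) -[X in `|X|](mul0r s).
    apply: cvg_norm; apply: cvgM; last exact: cvg_cst.
    exact: (cvg_within _).
  apply/norm_cvg0P; apply: (@squeeze_cvgr _ _ _ _ (cst 0) _ _ _ _ _ c).
    by apply: nearW => h; rewrite normr_ge0/= (thP h).1.
  exact: cvg_cst.
have c1 : p + h *: u + th h *: v @[h --> 0^'] --> p.
  have : p + h *: u + th h *: v @[h --> 0^'] --> p + (0 : R) *: u + (0 : R) *: v.
    apply: cvgD; last exact: cvgZr_tmp.
    apply: cvgD; first exact: cvg_cst.
    by apply: cvgZr_tmp; exact: (cvg_within _).
  by rewrite !scale0r !addr0.
have c2 : 'D_v L (p + h *: u + th h *: v) @[h --> 0^'] --> 'D_v L p.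
  have /subspace_continuousP/(_ p pab) cp := cDv.
  apply: (@cvg_comp _ _ _ (fun h => p + h *: u + th h *: v) (fun q => 'D_v L q)
    _ (within (slab a b) (nbhs p))); last exact: cp.
  move=> B AB; have h : \forall h \near 0^', slab a b (p + h *: u + th h *: v) ->
     B (p + h *: u + th h *: v) := c1 _ AB.
  by apply: filterS h => h; apply; apply: slabD => //; exact: slabD.
have c3 : h^-1 *: (L (h *: u + p) - L p) @[h --> 0^'] --> du.
  by rewrite -Eu; exact: dLu.
have c4 : h^-1 *: (L (h *: u + p) - L p) + s * 'D_v L (p + h *: u + th h *: v)
    @[h --> 0^'] --> du + s * 'D_v L p.
  by apply: cvgD => //; apply: cvgM => //; exact: cvg_cst.
apply: cvg_trans c4; apply: near_eq_cvg.
near=> h; have h0 : h != 0 by near: h; exact: nbhs_dnbhs_neq.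
have [_ E] := thP h.
have -> : L (h *: (u + s *: v) + p) =
   L (p + h *: u) + (h * s) * 'D_v L (p + h *: u + th h *: v).
  by rewrite -E [RHS]addrC subrK; congr (L _); rewrite scalerDr scalerA addrC addrA.
rewrite (addrC _ p) /GRing.scale/=; field; exact: h0.
Unshelve. all: by end_near. Qed.

Lemma is_derive_scale L p v (s : R) : slab a b p -> horizontal v ->
  (forall q, slab a b q -> derivable L q v) ->
  {within slab a b, continuous (fun q => 'D_v L q)} ->
  is_derive p (s *: v) L (s * 'D_v L p).
Proof.
move=> pab v0 dLv cDv.
have d0 : is_derive p 0 L 0.
  apply: cvg_is_derive; under eq_fun do rewrite scaler0 add0r subrr scaler0.
  exact: cvg_cst.
have := @is_deriveDZ L p 0 v 0 s pab erefl v0 d0 dLv cDv.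
by rewrite (add0r (s *: v)) (add0r (s * _)).
Qed.

(** [s] will hold the values at one point of h, of its derivative and of its combined Caputo
    derivative. *)
Definition variation (i : 'I_N) (s : R * R * R) : W :=
  s.1.1 *: ey i + s.1.2 *: eyp i + s.2 *: eD i.

Lemma horizontal_variation i s : horizontal (variation i s).
Proof. by rewrite /horizontal /variation/= !scaler0 !addr0. Qed.

Definition partials (i : 'I_N) L (s : R * R * R) p : R :=
  s.1.1 * dy i L p + s.1.2 * dyp i L p + s.2 * dD i L p.

(** Smoothness is given through partial derivatives; the combined direction is reached by adding the
    multiples of [ey i], [eyp i] and [eD i] one at a time. *)
Lemma is_derive_variation L i s p : C1_slab a b L -> slab a b p ->
  is_derive p (variation i s) L (partials i L s p).
Proof.
move=> [_ dL _ /(_ i) [c1 c2 c3]] pab.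
have h1 : horizontal (ey i : W) by [].
have h2 : horizontal (eyp i : W) by [].
have h3 : horizontal (eD i : W) by [].
rewrite /variation /partials.
have e1 q : slab a b q -> derivable L q (ey i) by move=> /dL[_ /(_ i)[]].
have e2 q : slab a b q -> derivable L q (eyp i) by move=> /dL[_ /(_ i)[]].
have e3 q : slab a b q -> derivable L q (eD i) by move=> /dL[_ /(_ i)[]].
have h4 : horizontal (s.1.1 *: ey i : W) by rewrite /horizontal/= scaler0.
have h5 : horizontal (s.1.1 *: ey i + s.1.2 *: eyp i : W).
  by rewrite /horizontal/= !scaler0 addr0.
have d1 := is_derive_scale s.1.1 pab h1 e1 c1.
have d2 := is_deriveDZ s.1.2 pab h4 h2 d1 e2 c2.
exact: (is_deriveDZ s.2 pab h5 h3 d2 e3 c3).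
Qed.

End SlabCalculus.

(** * First variation by differentiation under the integral sign *)

Section FirstVariation.
Context {R : realType} {N : nat} (a b : R).
Hypothesis ab : a < b.
Local Notation W := (R * 'rV[R]_N * 'rV[R]_N * 'rV[R]_N)%type.
Notation leb := (@lebesgue_measure R).
Variables (L : W -> R) (i : 'I_N).
Hypothesis LC1 : C1_slab a b L.
Variables (q : R -> W) (s : R -> R * R * R).
Hypotheses (cq : continuous q) (qab : forall x, slab a b (q x)).
Hypotheses (cs1 : continuous (fun x => (s x).1.1))
  (cs2 : continuous (fun x => (s x).1.2)) (cs3 : continuous (fun x => (s x).2)).

Let curve (z : R * R) : W := q z.2 + z.1 *: variation i (s z.2).

Let curve_slab z : slab a b (curve z).
Proof. by apply: slabD; [exact: horizontal_variation|exact: qab]. Qed.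

Let continuous_snd_comp (V : topologicalType) (f : R -> V) : continuous f ->
  continuous (fun z : R * R => f z.2).
Proof. by move=> cf z; apply: continuous_comp; [exact: cvg_snd|exact: cf]. Qed.

Let curve_continuous : continuous curve.
Proof.
have cv : continuous (fun x => variation i (s x)).
  move=> x; apply: cvgD; first apply: cvgD.
  - by apply: cvgZr_tmp; exact: cs1.
  - by apply: cvgZr_tmp; exact: cs2.
  - by apply: cvgZr_tmp; exact: cs3.
move=> z; apply: cvgD; first exact: continuous_snd_comp.
by apply: cvgZ; [exact: cvg_fst|exact: (continuous_snd_comp cv)].
Qed.

Let dcurve (z : R * R) := partials i L (s z.2) (curve z).

Let dcurve_continuous : continuous dcurve.
Proof.
have [_ _ _ /(_ i) [c1 c2 c3]] := LC1.
have c (f : W -> R) : {within slab a b, continuous f} -> continuous (f \o curve).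
  by move=> cf; apply: (continuous_within_comp cf).
move=> z; apply: cvgD; first apply: cvgD.
- by apply: cvgM; [exact: (continuous_snd_comp cs1)|exact: (c _ c1)].
- by apply: cvgM; [exact: (continuous_snd_comp cs2)|exact: (c _ c2)].
- by apply: cvgM; [exact: (continuous_snd_comp cs3)|exact: (c _ c3)].
Qed.

Let slice_continuous (f : R * R -> R) e : continuous f -> continuous (fun x => f (e, x)).
Proof.
move=> cf x; apply: (@continuous_comp _ _ _ (fun x => (e, x)) f); last exact: cf.
apply: (@cvg_pair R R R (nbhs x) (nbhs e) (nbhs x) _ _ _ (fun=> e) id).
  exact: cvg_cst.
exact: cvg_id.
Qed.

(** Fermat's rule at e = 0 for the integral as a function of e on ]-r, r[, whose derivative is
    computed under the integral sign. *)
Lemma first_variation (r : R) : 0 < r ->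
  (forall e : R, `|e| < r -> \int[leb]_(x in `[a, b]) L (q x) <=
     \int[leb]_(x in `[a, b]) L (q x + e *: variation i (s x))) ->
  \int[leb]_(x in `[a, b]) partials i L (s x) (q x) = 0.
Proof.
move=> r0 Lmin.
pose F e x := L (curve (e, x)).
have cLcurve : continuous (L \o curve).
  by case: LC1 => cL _ _ _; apply: (continuous_within_comp cL).
have iF e : leb.-integrable `[a, b] (EFin \o F e).
  by apply: continuous_integrable; exact: (slice_continuous cLcurve).
have dF (e x : R) : is_derive e 1 (F ^~ x) (dcurve (e, x)).
  have [d1 d2] := is_derive_variation i (s x) LC1 (curve_slab (e, x)).
  by have := is_derive_line d1; rewrite d2.
have d1F e x : partial1of2 F e x = dcurve (e, x).
  by rewrite partial1of2E; have [_ ->] := dF e x.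
(* The dominating constant: the derivative in e is continuous, hence bounded, on the compact
   rectangle [-r, r] x [a, b]. *)
have [M MP] : exists M, forall e x, e \in `](- r), r[ -> x \in `[a, b] -> `|dcurve (e, x)| <= M.
  have : compact (dcurve @` (`[- r, r] `*` `[a, b])).
    apply: continuous_compact; first exact: continuous_subspaceT.
    by apply: compact_setX; exact: segment_compact.
  move=> /compact_bounded [M [_ MP]]; exists (M + 1) => e x er xab.
  apply: (MP (M + 1)); first by rewrite ltrDl.
  exists (e, x) => //; split => //=.
  by move: er; rewrite !in_itv/= => /andP[/ltW -> /ltW ->].
have M0 : 0 <= M.
  apply: le_trans (MP 0 a _ _); rewrite ?in_itv/= ?lexx ?(ltW ab)//.
  by rewrite oppr_lt0 r0.
have iM : leb.-integrable `[a, b] (EFin \o (fun=> M)).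
  by apply: continuous_integrable => x; exact: cvg_cst.
pose J e := \int[leb]_(x in `[a, b]) F e x.
have dJ e : e \in `](- r), r[ -> derivable J e 1 /\
    J^`()%classic e = \int[leb]_(x in `[a, b]) dcurve (e, x).
  move=> er.
  have H1 : forall x y, `](- r), r[%classic x -> `[a, b]%classic y -> derivable (F ^~ y) x 1.
    by move=> x y _ _; have [] := dF x y.
  have H2 : forall x y, `](- r), r[%classic x -> `[a, b]%classic y -> `|partial1of2 F x y| <= M.
    by move=> x y xr yab; rewrite d1F; apply: MP.
  split.
    exact: (@derivable_under_integral R _ _ leb F `[a, b]%classic (measurable_itv _) e (- r) r er
      (fun x _ => iF x) H1 (fun=> M) (fun=> M0) iM H2).
  rewrite (@differentiation_under_integral R _ _ leb F `[a, b]%classic (measurable_itv _) e (- r) r er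
      (fun x _ => iF x) H1 (fun=> M) (fun=> M0) iM H2).
  by apply: eq_Rintegral => x _; rewrite -d1F.
have zr : (0 : R) \in `](- r), r[ by rewrite in_itv/= oppr_lt0 r0.
have J0 : J 0 = \int[leb]_(x in `[a, b]) L (q x).
  by apply: eq_Rintegral => x _; rewrite /F /curve/= scale0r addr0.
have [_ D0] : is_derive (0 : R) 1 J 0.
  apply: (@derive1_at_min _ J (- r) r 0) => //.
  - by rewrite ge0_cp// ltW.
  - by move=> t tr; have [] := dJ t tr.
  - move=> t; rewrite in_itv/= => /andP[rt tr]; rewrite J0; apply: Lmin.
    by rewrite ltr_norml rt.
have [_] := dJ 0 zr; rewrite derive1E D0 => ->.
by apply: eq_Rintegral => x _; rewrite /dcurve /curve/= scale0r addr0.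
Qed.

End FirstVariation.

(** * Linearity of the Caputo derivative; du Bois-Reymond lemmas *)

Section CaputoLinearity.
Context {R : realType} (a b : R).
Hypothesis ab : a < b.
Notation leb := (@lebesgue_measure R).
Implicit Types (f g h : R -> R) (x k e : R).

Definition C1_on f := (forall x, x \in `[a, b] -> derivable_on a b f x) /\
  {within `[a, b], continuous (deriv_on a b f)}.

Lemma deriv_onDZ f g k x : x \in `[a, b] ->
  derivable_on a b f x -> derivable_on a b g x ->
  derivable_on a b (fun t => f t + k * g t) x /\
  deriv_on a b (fun t => f t + k * g t) x = deriv_on a b f x + k * deriv_on a b g x.
Proof.
move=> xab df dg; apply: has_deriv_onP => //.
by apply: has_deriv_onDZ; exact: derivable_onP.
Qed.

Lemma caputo_combDZ (al be ga : R) f g k x : al < 1 -> be < 1 -> x \in `[a, b] ->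
  C1_on f -> C1_on g ->
  caputo_comb a b al be ga (fun t => f t + k * g t) x =
  caputo_comb a b al be ga f x + k * caputo_comb a b al be ga g x.
Proof.
move=> al1 be1 xab [df cdf] [dg cdg].
have ab' := ltW ab.
(* Linearity of fractional integrals is available for functions continuous on the line, while these
   derivatives are continuous only within [a, b]. *)
pose F := deriv_on a b f \o clamp a b; pose G := deriv_on a b g \o clamp a b.
have cF : continuous F by exact: continuous_clamp_comp.
have cG : continuous G by exact: continuous_clamp_comp.
have FE : {in `[a, b], deriv_on a b f =1 F}.
  by move=> t tab; rewrite /F/= clamp_id.
have GE : {in `[a, b], deriv_on a b g =1 G}.
  by move=> t tab; rewrite /G/= clamp_id.
have FGE : {in `[a, b], deriv_on a b (fun t => f t + k * g t) =1 (fun t => F t + k * G t)}.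
  by move=> t tab; rewrite (deriv_onDZ k tab (df _ tab) (dg _ tab)).2 FE ?GE.
have cN H : continuous H -> continuous (fun t : R => - H t : R).
  by move=> cH t; apply: cvgN; exact: cH.
have l : rl_intl a (1 - al) (deriv_on a b (fun t => f t + k * g t)) x =
  rl_intl a (1 - al) (deriv_on a b f) x + k * rl_intl a (1 - al) (deriv_on a b g) x.
  rewrite /rl_intl -!/(Il _ _ _ _) (eq_Il _ xab FE) (eq_Il _ xab GE) (eq_Il _ xab FGE).
  by rewrite IlDZ ?subr_gt0//; ring.
have FN : {in `[a, b], (fun t => - deriv_on a b f t) =1 (fun t => - F t)}.
  by move=> t tab; rewrite FE.
have GN : {in `[a, b], (fun t => - deriv_on a b g t) =1 (fun t => - G t)}.
  by move=> t tab; rewrite GE.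
have FGN : {in `[a, b], (fun t => - deriv_on a b (fun t => f t + k * g t) t) =1
    (fun t => - F t + k * - G t)}.
  by move=> t tab; rewrite FGE//; ring.
have r : caputor a b be (fun t => f t + k * g t) x =
  caputor a b be f x + k * caputor a b be g x.
  rewrite /caputor /rl_intr -!/(Ir _ _ _ _) (eq_Ir _ xab FN) (eq_Ir _ xab GN) (eq_Ir _ xab FGN).
  rewrite (IrDZ b k x _ (cN _ cF) (cN _ cG)) ?subr_gt0//; ring.
by rewrite /caputo_comb r /caputol l; ring.
Qed.

Lemma C1_on0 : C1_on (fun=> 0).
Proof.
have d x : x \in `[a, b] -> derivable_on a b (fun=> 0) x /\ deriv_on a b (fun=> 0) x = 0.
  by move=> xab; apply: has_deriv_onP => //; exact: has_deriv_on_cst.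
split; first by move=> x /d[].
apply: (@eq_within_continuous _ _ _ (fun=> 0)).
  by move=> x xab; rewrite (d x xab).2.
by move=> x; exact: cvg_cst.
Qed.

Lemma caputo_comb0 (al be ga : R) x : al < 1 -> be < 1 -> x \in `[a, b] ->
  caputo_comb a b al be ga (fun=> 0) x = 0.
Proof.
move=> al1 be1 xab.
(* The value v at the zero function satisfies v = v + v. *)
have := caputo_combDZ ga 1 al1 be1 xab C1_on0 C1_on0.
have -> : (fun t : R => (0 : R) + 1 * 0) = (fun=> 0).
  by apply/funext => t; rewrite mulr0 addr0.
by rewrite mul1r; lra.
Qed.

Context {N : nat}.
Implicit Types (y : R -> 'rV[R]_N).

(** The value, the derivative and the Caputo derivative are linear in y, so perturbing y moves the
    argument of L along a straight line, and the first variation becomes a directional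
    derivative. *)
Lemma lift_curve_variation (al be ga : R) y h (i : 'I_N) e x : al < 1 -> be < 1 ->
  x \in `[a, b] -> (forall j, C1_on (fun t => y t 0 j)) -> C1_on h ->
  lift_curve a b al be ga (fun t => y t + (e * h t) *: delta_mx 0 i) x =
  lift_curve a b al be ga y x +
    e *: variation i (h x, deriv_on a b h x, caputo_comb a b al be ga h x).
Proof.
move=> al1 be1 xab Cy Ch.
have E (j : 'I_N) : (fun t => (y t + (e * h t) *: delta_mx 0 i : 'rV_N) 0 j) =
    (fun t => y t 0 j + (e * (j == i)%:R) * h t).
  by apply/funext => t; rewrite !mxE eqxx/=; ring.
have P (p1 p2 p3 : R) : variation i (p1, p2, p3) =
    (0, p1 *: delta_mx 0 i, p2 *: delta_mx 0 i, p3 *: delta_mx 0 i).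
  rewrite /variation/= /ey /eyp /eD.
  have T (u1 v1 : R) (u2 u3 u4 v2 v3 v4 : 'rV[R]_N) :
    (u1, u2, u3, u4) + (v1, v2, v3, v4) = (u1 + v1, u2 + v2, u3 + v3, u4 + v4) by [].
  have S (c u1 : R) (u2 u3 u4 : 'rV[R]_N) :
    c *: (u1, u2, u3, u4) = (c *: u1, c *: u2, c *: u3, c *: u4) by [].
  by rewrite !S !T !scaler0 !addr0 !add0r.
have T (u1 v1 : R) (u2 u3 u4 v2 v3 v4 : 'rV[R]_N) :
    (u1, u2, u3, u4) + (v1, v2, v3, v4) = (u1 + v1, u2 + v2, u3 + v3, u4 + v4) by [].
have S (c u1 : R) (u2 u3 u4 : 'rV[R]_N) :
    c *: (u1, u2, u3, u4) = (c *: u1, c *: u2, c *: u3, c *: u4) by [].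
rewrite P S /lift_curve T scaler0 addr0 scalerA; congr (_, _, _, _).
- apply/rowP => j; rewrite !mxE E.
  rewrite (deriv_onDZ _ xab ((Cy j).1 x xab) (Ch.1 x xab)).2 eqxx/=; ring.
- apply/rowP => j; rewrite !mxE E.
  rewrite (caputo_combDZ ga _ al1 be1 xab (Cy j) Ch) eqxx/=; ring.
Qed.

End CaputoLinearity.

Section DuBoisReymond.
Context {R : realType} (a b : R).
Hypothesis ab : a < b.
Notation leb := (@lebesgue_measure R).

Lemma within_continuous_integrable (f : R -> R) : {within `[a, b], continuous f} ->
  leb.-integrable `[a, b] (EFin \o f).
Proof.
by move=> cf; apply: continuous_compact_integrable => //; exact: segment_compact.
Qed.

Lemma du_bois_reymond (f : R -> R) : {within `[a, b], continuous f} ->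
  (forall g : R -> R, continuous g -> \int[leb]_(x in `[a, b]) g x = 0 ->
    \int[leb]_(x in `[a, b]) (g x * f x) = 0) ->
  exists c, {in `[a, b], forall x, f x = c}.
Proof.
move=> cf fg; pose F := f \o clamp a b.
have cF : continuous F by apply: continuous_clamp_comp => //; exact: ltW.
(* With c the mean of f, the function g = f - c is itself a test function, and the integral of g^2
   is that of g f minus c times that of g, hence 0. *)
pose c := (\int[leb]_(x in `[a, b]) F x) / (b - a).
pose g x := F x - c.
have cg : continuous g by move=> x; apply: cvgB; [exact: cF|exact: cvg_cst].
have ic : leb.-integrable `[a, b] (EFin \o (fun=> c)).
  by apply: continuous_integrable => x; exact: cvg_cst.
have iF := continuous_integrable a b cF.
have ig := continuous_integrable a b cg.
have g0 : \int[leb]_(x in `[a, b]) g x = 0.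
  rewrite RintegralB// Rintegral_cst//= lebesgue_measure_itv/= lte_fin ab/=.
  by rewrite /c divfK ?subrr// subr_eq0 gt_eqF.
exists c => x xab; apply/eqP; rewrite -subr_eq0; apply/eqP.
rewrite -[f x]/(f x) -{1}(clamp_id xab) -/(F x) -/(g x).
apply: (Rintegral_sqr_eq0 ab cg) => //.
have cgF : continuous (fun x => g x * F x).
  by move=> y; apply: cvgM; [exact: cg|exact: cF].
have cgc : continuous (fun x => c * g x).
  by move=> y; apply: cvgM; [exact: cvg_cst|exact: cg].
have -> : \int[leb]_(x in `[a, b]) g x ^+ 2 =
    \int[leb]_(x in `[a, b]) (g x * F x - c * g x).
  by apply: eq_Rintegral => y _; rewrite /g; ring.
rewrite RintegralB//; last 2 first.
- exact: continuous_integrable.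
- exact: continuous_integrable.
rewrite RintegralZl// g0 mulr0 subr0.
rewrite (_ : \int[leb]_(x in `[a, b]) (g x * F x) = \int[leb]_(x in `[a, b]) (g x * f x)).
  by rewrite fg.
by apply: eq_Rintegral => y; rewrite inE/= => yab; rewrite /F/= clamp_id.
Qed.

End DuBoisReymond.

(** * Admissible variations *)

Section Admissible.
Context {R : realType} {N : nat} (a b : R).
Hypothesis ab : a < b.
Variables (al be ga : R).
Hypotheses (al01 : 0 < al < 1) (be01 : 0 < be < 1).
Notation leb := (@lebesgue_measure R).
Implicit Types (y : R -> 'rV[R]_N) (g h : R -> R).

Let al1 : al < 1. Proof. by case/andP: al01. Qed.
Let be1 : be < 1. Proof. by case/andP: be01. Qed.

Lemma in_D_C1 y : in_D a b al be ga y -> forall j, C1_on a b (fun t => y t 0 j).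
Proof.
move=> [dy cdy _] j; split; first exact: dy.
apply: (@eq_within_continuous _ _ _ ((fun u : 'rV[R]_N => u 0 j) \o vderiv_on a b y)).
  by move=> x _; rewrite /= mxE.
move=> x; apply: (@continuous_comp _ _ _ (vderiv_on a b y : subspace _ -> _)).
  exact: cdy.
exact: coord_continuous.
Qed.

(** [in_D] states continuity for the derivatives only; that of y follows componentwise from
    differentiability. *)
Lemma in_D_continuous y : in_D a b al be ga y -> {within `[a, b], continuous y}.
Proof.
move=> [dy _ _]; apply/subspace_continuousP => x xab.
have -> : y = (fun t => \sum_(j < N) y t 0 j *: delta_mx 0 j).
  by apply/funext => t; exact: row_sum_delta.
apply: (cvg_big add_continuous) => j _; apply: cvgZr_tmp.
exact: (has_deriv_on_continuous (derivable_onP (dy j x xab))).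
Qed.

Lemma within_continuous_pair (T U V : topologicalType) (A : set T) (f : T -> U) (g : T -> V) :
  {within A, continuous f} -> {within A, continuous g} ->
  {within A, continuous (fun t => (f t, g t))}.
Proof.
move=> cf cg t.
exact: (@cvg_pair _ _ _ (nbhs (t : subspace A)) (nbhs (f t)) (nbhs (g t)) _ _ _ f g (cf t) (cg t)).
Qed.

Lemma in_D_lift_curve y : in_D a b al be ga y ->
  {within `[a, b], continuous (lift_curve a b al be ga y)}.
Proof.
move=> Dy; have [_ c2 c3] := Dy; have c1 := in_D_continuous Dy.
have c0 : {within `[a, b], continuous (id : R -> R)}.
  by apply: continuous_subspaceT => x; exact: cvg_id.
exact: within_continuous_pair (within_continuous_pair (within_continuous_pair c0 c1) c2) c3.
Qed.

Section Primitive.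
Variable g : R -> R.
Hypothesis cg : continuous g.
Let h := Il a 1 g.

Lemma primitive_deriv x : x \in `[a, b] -> derivable_on a b h x /\ deriv_on a b h x = g x.
Proof. by move=> xab; apply: has_deriv_onP => //; exact: Il1_has_deriv_on. Qed.

Lemma primitive_C1 : C1_on a b h.
Proof.
split; first by move=> x /primitive_deriv[].
apply: (@eq_within_continuous _ _ _ g).
  by move=> x xab; rewrite (primitive_deriv xab).2.
exact: continuous_subspaceT.
Qed.

(** Since h' = g on [a, b], the Caputo derivatives of h become fractional integrals of g, which are
    continuous and can be integrated by parts. *)
Lemma primitive_caputo x : x \in `[a, b] -> caputo_comb a b al be ga h x =
  ga * ((Gamma (1 - al))^-1 * Il a (1 - al) g x) +
  (1 - ga) * ((Gamma (1 - be))^-1 * Ir b (1 - be) (fun t => - g t) x).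
Proof.
move=> xab; rewrite /caputo_comb /caputol /caputor /rl_intl /rl_intr.
rewrite -/(Il _ _ _ _) -/(Ir _ _ _ _).
rewrite (@eq_Il _ a b _ _ g x xab); last by move=> t /primitive_deriv[].
rewrite (@eq_Ir _ a b _ _ (fun t => - g t) x xab)//.
by move=> t /primitive_deriv[_ ->].
Qed.

Lemma primitive_caputo_continuous :
  {within `[a, b], continuous (caputo_comb a b al be ga h)}.
Proof.
have [al0 _] := andP al01; have [be0 _] := andP be01.
have cNg : continuous (fun t => - g t) by move=> t; apply: cvgN; exact: cg.
apply: (@eq_within_continuous _ _ _ (fun x =>
  ga * ((Gamma (1 - al))^-1 * Il a (1 - al) g x) +
  (1 - ga) * ((Gamma (1 - be))^-1 * Ir b (1 - be) (fun t => - g t) x))).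
  by move=> x xab; rewrite primitive_caputo.
move=> x; apply: cvgD.
  apply: cvgM; first exact: cvg_cst.
  apply: cvgM; first exact: cvg_cst.
  by apply: Il_continuous => //; rewrite ?subr_gt0// gerBl ltW.
apply: cvgM; first exact: cvg_cst.
apply: cvgM; first exact: cvg_cst.
by apply: Ir_continuous => //; rewrite ?subr_gt0// gerBl ltW.
Qed.

Variables (y : R -> 'rV[R]_N) (i : 'I_N).
Hypothesis Dy : in_D a b al be ga y.

Let z e := fun t => y t + (e * h t) *: delta_mx 0 i.

Lemma lift_curve_primitive e x : x \in `[a, b] ->
  lift_curve a b al be ga (z e) x = lift_curve a b al be ga y x +
    e *: variation i (h x, deriv_on a b h x, caputo_comb a b al be ga h x).
Proof.
move=> xab; apply: lift_curve_variation => //; first exact: in_D_C1.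
exact: primitive_C1.
Qed.

Lemma vderiv_primitive e x : x \in `[a, b] ->
  vderiv_on a b (z e) x = vderiv_on a b y x + (e * g x) *: delta_mx 0 i.
Proof.
move=> xab; have := congr1 (fun p => p.1.2) (lift_curve_primitive e xab).
by rewrite /= !scaler0 add0r addr0 scalerA (primitive_deriv xab).2.
Qed.

Lemma vcaputo_primitive e x : x \in `[a, b] ->
  vcaputo a b al be ga (z e) x =
  vcaputo a b al be ga y x + (e * caputo_comb a b al be ga h x) *: delta_mx 0 i.
Proof.
move=> xab; have := congr1 (fun p => p.2) (lift_curve_primitive e xab).
by rewrite /= !scaler0 !add0r scalerA.
Qed.

Lemma primitive_in_D e : in_D a b al be ga (z e).
Proof.
have [dy cdy cDy] := Dy.
split.
- move=> j x xab.
  have E : (fun t => z e t 0 j) = (fun t => y t 0 j + (e * (j == i)%:R) * h t).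
    by apply/funext => t; rewrite !mxE eqxx/=; ring.
  by rewrite E; apply: (deriv_onDZ ab _ xab (dy j x xab) (primitive_deriv xab).1).1.
- apply: (@eq_within_continuous _ _ _ (fun x => vderiv_on a b y x + (e * g x) *: delta_mx 0 i)).
    by move=> x xab; rewrite vderiv_primitive.
  move=> x; apply: cvgD; first exact: cdy.
  apply: cvgZr_tmp; apply: cvgM; first exact: cvg_cst.
  exact: (continuous_subspaceT cg).
- apply: (@eq_within_continuous _ _ _
    (fun x => vcaputo a b al be ga y x + (e * caputo_comb a b al be ga h x) *: delta_mx 0 i)).
    by move=> x xab; rewrite vcaputo_primitive.
  move=> x; apply: cvgD; first exact: cDy.
  apply: cvgZr_tmp; apply: cvgM; first exact: cvg_cst.
  exact: primitive_caputo_continuous.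
Qed.

End Primitive.

Lemma within_continuous_bounded (f : R -> R) : {within `[a, b], continuous f} ->
  exists2 M, 0 <= M & forall x, x \in `[a, b] -> `|f x| <= M.
Proof.
move=> cf; have := @continuous_bounded_itv R (f \o clamp a b) a b
  (continuous_clamp_comp (ltW ab) cf).
move=> [M [_ MP]]; exists (`|M| + 1) => [|x xab]; first by rewrite addr_ge0.
have := MP (`|M| + 1); rewrite (le_lt_trans (ler_norm M)) ?ltrDl// => /(_ isT x xab).
by rewrite /= clamp_id.
Qed.

(** The three functions measured by the norm are e times fixed bounded functions in direction i, so
    one K works for all y and e. *)
Lemma norm1oo_primitive (nrm : 'rV[R]_N -> R) g (i : 'I_N) : is_norm nrm -> continuous g ->
  exists2 K, 0 <= K & forall (y : R -> 'rV[R]_N) e,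
    norm1oo nrm a b al be ga
      ((fun t => y t + (e * Il a 1 g t) *: delta_mx 0 i) \- y) <= `|e| * K.
Proof.
move=> [nD nZ _] cg; pose h := Il a 1 g.
pose nd := nrm (delta_mx 0 i).
(* Nonnegativity is not an axiom of [is_norm]; it follows from 0 = nrm (u - u) <= 2 nrm u. *)
have nd0 : 0 <= nd.
  have := nD (delta_mx 0 i) (- delta_mx 0 i); rewrite subrr.
  rewrite -scaleN1r nZ normrN normr1 mul1r -/nd.
  rewrite -[X in nrm X](scale0r (0 : 'rV[R]_N)) nZ normr0 mul0r; lra.
have [M1 M10 M1P] := within_continuous_bounded
  (@Il_continuous R a b 1 g ltr01 (lexx 1) cg).
have [M2 M20 M2P] := within_continuous_bounded (continuous_subspaceT (A := `[a, b]) cg).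
have [M3 M30 M3P] := within_continuous_bounded (primitive_caputo_continuous cg).
exists (M1 * nd + M2 * nd + M3 * nd); first by rewrite !addr_ge0// mulr_ge0.
move=> y e.
(* The difference is the same perturbation applied to the zero function, so the formulas for
   perturbed functions can be used with y = 0. *)
have -> : ((fun t => y t + (e * h t) *: delta_mx 0 i) \- y) =
    (fun t => (fun=> 0) t + (e * h t) *: delta_mx 0 i).
  by apply/funext => t; rewrite /= addrC addKr add0r.
have V0 x : x \in `[a, b] -> vderiv_on a b (fun=> 0 : 'rV[R]_N) x = 0.
  move=> xab; apply/rowP => j; rewrite !mxE.
  by apply: (has_deriv_onP ab xab (has_deriv_on_cst _ _)).2.
have C0 x : x \in `[a, b] -> vcaputo a b al be ga (fun=> 0 : 'rV[R]_N) x = 0.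
  move=> xab; apply/rowP => j; rewrite !mxE.
  exact: caputo_comb0.
have D0 : in_D a b al be ga (fun=> 0 : 'rV[R]_N).
  split.
  - move=> j x xab; under eq_fun do rewrite mxE.
    by apply: (has_deriv_onP ab xab (has_deriv_on_cst _ _)).1.
  - apply: (@eq_within_continuous _ _ _ (fun=> (0 : 'rV[R]_N))) => [x xab|x]; first by rewrite V0.
    exact: cvg_cst.
  - apply: (@eq_within_continuous _ _ _ (fun=> (0 : 'rV[R]_N))) => [x xab|x]; first by rewrite C0.
    exact: cvg_cst.
have bound (w : R -> 'rV[R]_N) (f : R -> R) M :
    {in `[a, b], forall x, w x = (e * f x) *: delta_mx 0 i} ->
    (forall x, x \in `[a, b] -> `|f x| <= M) ->
    max_norm nrm a b w <= `|e| * (M * nd).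
  move=> wE fM; apply: ge_sup.
    by exists (nrm (w a)), a => //=; rewrite in_itv/= lexx ltW.
  move=> _ [x xab <-]; rewrite wE// nZ normrM -mulrA ler_wpM2l// ler_wpM2r//.
  exact: fM.
rewrite !mulrDr /norm1oo; apply: lerD; first apply: lerD.
- by apply: (bound _ h) => // x xab; rewrite add0r.
- apply: (bound _ g) => // x xab.
  by rewrite (vderiv_primitive cg i D0)// V0// add0r.
- apply: (bound _ (caputo_comb a b al be ga h)) => // x xab.
  by rewrite (vcaputo_primitive cg i D0)// C0// add0r.
Qed.

End Admissible.

(** * The Euler-Lagrange equation *)

Lemma mulr_lt_divD1 (R : realFieldType) (K d u : R) : 0 <= K -> 0 <= u -> u < d / (K + 1) -> u * K < d.
Proof.
move=> K0 u0; rewrite ltr_pdivlMr ?ltr_wpDl// mulrDr mulr1.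
by apply: le_lt_trans; rewrite lerDl.
Qed.

Lemma Rintegral_lincomb4 (R : realType) (a b k3 k4 : R) (f1 f2 f3 f4 : R -> R) :
  let mu := @lebesgue_measure R in
  mu.-integrable `[a, b] (EFin \o f1) -> mu.-integrable `[a, b] (EFin \o f2) ->
  mu.-integrable `[a, b] (EFin \o f3) -> mu.-integrable `[a, b] (EFin \o f4) ->
  \int[mu]_(x in `[a, b]) (f1 x + f2 x + k3 * f3 x + k4 * f4 x) =
  \int[mu]_(x in `[a, b]) f1 x + \int[mu]_(x in `[a, b]) f2 x +
  k3 * \int[mu]_(x in `[a, b]) f3 x + k4 * \int[mu]_(x in `[a, b]) f4 x.
Proof.
move=> mu i1 i2 i3 i4.
have IZ k f : mu.-integrable `[a, b] (EFin \o f) ->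
    mu.-integrable `[a, b] (EFin \o (fun x => k * f x)).
  move=> fi; have := @integrableZl _ _ _ mu _ (measurable_itv _) k _ fi.
  by apply: eq_integrable.
have ID f g : mu.-integrable `[a, b] (EFin \o f) ->
    mu.-integrable `[a, b] (EFin \o g) ->
    mu.-integrable `[a, b] (EFin \o (fun x => f x + g x)).
  move=> fi gi; have h := integrableD _ fi gi.
  by apply: eq_integrable (h _).
have D f g := @RintegralD _ _ R mu `[a, b]%classic f g (measurable_itv _).
have i12 := ID _ _ i1 i2; have j3 := IZ k3 _ i3; have j4 := IZ k4 _ i4.
have i123 := ID _ _ i12 j3.
rewrite (D (fun x => f1 x + f2 x + k3 * f3 x) (fun x => k4 * f4 x) i123 j4).
rewrite (D (fun x => f1 x + f2 x) (fun x => k3 * f3 x) i12 j3) (D f1 f2 i1 i2).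
by rewrite !RintegralZl.
Qed.

(** * From constancy to the differential equation *)

Section EulerLagrangeOfConstant.
Context {R : realType} (a b : R).
Hypothesis ab : a < b.
Variables (al be ga c : R) (A C Ly Lyp LD : R -> R).
Hypothesis cA : continuous A.
Hypotheses (AE : {in `[a, b], A =1 Ly}) (CE : {in `[a, b], C =1 LD}).

Let G t := Lyp t - rl_comb_int a b be al (1 - ga) LD t.

(** On [a, b] the hypothesis reads G = c - [Ir b 1 A], whose derivative is [A]. Where the fractional
    derivatives exist, [Lyp] is G plus differentiable terms, so the derivative of G splits. *)
Lemma euler_lagrange_of_constant x :
  (forall t, t \in `[a, b] -> Ir b 1 A t + Lyp t +
     (ga * (Gamma (1 - al))^-1) * Ir b (1 - al) C t -
     ((1 - ga) * (Gamma (1 - be))^-1) * Il a (1 - be) C t = c) ->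
  x \in `[a, b] ->
  (derivable_on a b G x /\ Ly x - deriv_on a b G x = 0) /\
  (rl_comb_exists a b be al (1 - ga) LD x -> derivable_on a b Lyp x /\
   Ly x - deriv_on a b Lyp x + rl_comb a b be al (1 - ga) LD x = 0).
Proof.
move=> cP xab.
have hG : has_deriv_on (a := a) (b := b) G x (Ly x).
  apply: (@has_deriv_on_eq _ _ _ (fun t => c + (-1) * Ir b 1 A t)) => //.
    move=> t tab; rewrite /G /rl_comb_int /rl_intl /rl_intr -(cP t tab).
    rewrite -/(Il a (1 - be) LD t) -/(Ir b (1 - al) LD t).
    by rewrite -(eq_Il (1 - be) tab CE) -(eq_Ir (1 - al) tab CE); ring.
  have := has_deriv_onDZ (k := -1) (has_deriv_on_cst (a := a) (b := b) x c)
    (Ir1_has_deriv_on cA xab).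
  by rewrite add0r mulrNN mul1r (AE xab).
have [dG G'] := has_deriv_onP ab xab hG.
split; first by split=> //; rewrite G' subrr.
move=> [exl exr].
have hl : has_deriv_on (a := a) (b := b)
    (fun t => (1 - ga) * rl_intl a (1 - be) LD t) x ((1 - ga) * rl_derivl a b be LD x).
  (* With coefficient 0 the fractional derivative may fail to exist, but the product is then
     constantly 0. *)
  have [c0|c0] := eqVneq (1 - ga) 0.
    rewrite c0 mul0r; under eq_fun do rewrite mul0r.
    exact: has_deriv_on_cst.
  have := has_deriv_onDZ (k := 1 - ga) (has_deriv_on_cst (a := a) (b := b) x 0)
    (derivable_onP (exl c0)).
  by under eq_fun do rewrite add0r; rewrite add0r.
have hr : has_deriv_on (a := a) (b := b)
    (fun t => (- (1 - (1 - ga))) * rl_intr b (1 - al) LD t) x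
    ((1 - (1 - ga)) * rl_derivr a b al LD x).
  have [c0|c0] := eqVneq (1 - ga) 1.
    rewrite c0 subrr mul0r oppr0; under eq_fun do rewrite mul0r.
    exact: has_deriv_on_cst.
  have := has_deriv_onDZ (k := - (1 - (1 - ga))) (has_deriv_on_cst (a := a) (b := b) x 0)
    (derivable_onP (exr c0)).
  by under eq_fun do rewrite add0r; rewrite add0r /rl_derivr mulrN mulNr.
have hLyp : has_deriv_on (a := a) (b := b) Lyp x
    (Ly x + 1 * (rl_comb a b be al (1 - ga) LD x)).
  have := has_deriv_onDZ (k := 1) hG (has_deriv_onDZ (k := 1) hl hr).
  rewrite /rl_comb !mul1r; apply: has_deriv_on_eq => // t _.
  by rewrite /G /rl_comb_int; ring.
have [dLyp ->] := has_deriv_onP ab xab hLyp.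
by split=> //; ring.
Qed.

End EulerLagrangeOfConstant.

(** * Moving the integral operators off the test function *)

Section FractionalDuBoisReymond.
Context {R : realType} (a b : R).
Hypothesis ab : a < b.
Variables (al be ga : R) (A B C : R -> R).
Hypotheses (al01 : 0 < al < 1) (be01 : 0 < be < 1).
Hypotheses (cA : continuous A) (cB : continuous B) (cC : continuous C).
Notation leb := (@lebesgue_measure R).
Hypothesis stationary : forall g : R -> R, continuous g ->
  \int[leb]_(x in `[a, b]) g x = 0 ->
  \int[leb]_(x in `[a, b]) (A x * Il a 1 g x + B x * g x +
    C x * caputo_comb a b al be ga (Il a 1 g) x) = 0.

Let cl : R := ga * (Gamma (1 - al))^-1.
Let cr : R := (1 - ga) * (Gamma (1 - be))^-1.

(** The factor of g after integration by parts: left and right integrals change sides, so [al] now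
    goes with [Ir] and [be] with [Il]. The minus sign is that of the right Caputo derivative. *)
Let Psi x : R :=
  Ir b 1 A x + B x + cl * Ir b (1 - al) C x - cr * Il a (1 - be) C x.

Let al0 : 0 < 1 - al. Proof. by case/andP: al01; rewrite subr_gt0. Qed.
Let be0 : 0 < 1 - be. Proof. by case/andP: be01; rewrite subr_gt0. Qed.
Let al1 : 1 - al <= 1. Proof. by case/andP: al01 => /ltW; rewrite gerBl. Qed.
Let be1 : 1 - be <= 1. Proof. by case/andP: be01 => /ltW; rewrite gerBl. Qed.

Let within_continuousZ (k : R) (f : R -> R) : {within `[a, b], continuous f} ->
  {within `[a, b], continuous (fun x => k * f x)}.
Proof. by move=> cf x; apply: cvgM; [exact: cvg_cst|exact: cf]. Qed.

Let within_continuousM (f g : R -> R) : continuous g -> {within `[a, b], continuous f} ->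
  {within `[a, b], continuous (fun x => g x * f x)}.
Proof. by move=> cg cf x; apply: cvgM; [exact: (continuous_subspaceT cg)|exact: cf]. Qed.

Let cPsi : {within `[a, b], continuous Psi}.
Proof.
move=> x; apply: cvgB; first apply: cvgD; first apply: cvgD.
- exact: Ir_continuous.
- exact: (continuous_subspaceT cB).
- by apply: within_continuousZ; exact: Ir_continuous.
- by apply: within_continuousZ; exact: Il_continuous.
Qed.

Lemma variation_eq0 (g : R -> R) : continuous g ->
  \int[leb]_(x in `[a, b]) g x = 0 ->
  \int[leb]_(x in `[a, b]) (g x * Psi x) = 0.
Proof.
move=> cg g0; rewrite -[RHS](stationary cg g0).
have cNg : continuous (fun t => - g t) by move=> t; apply: cvgN; exact: cg.
have I f : {within `[a, b], continuous f} -> leb.-integrable `[a, b] (EFin \o f).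
  exact: within_continuous_integrable.
have iA : leb.-integrable `[a, b] (EFin \o (fun x => A x * Il a 1 g x)).
  by apply: I; apply: within_continuousM => //; exact: Il_continuous.
have iB : leb.-integrable `[a, b] (EFin \o (fun x => B x * g x)).
  by apply: I; apply: within_continuousM => //; exact: continuous_subspaceT.
have iCl : leb.-integrable `[a, b] (EFin \o (fun x => C x * Il a (1 - al) g x)).
  by apply: I; apply: within_continuousM => //; exact: Il_continuous.
have iCr : leb.-integrable `[a, b] (EFin \o (fun x => C x * Ir b (1 - be) (fun t => - g t) x)).
  by apply: I; apply: within_continuousM => //; exact: Ir_continuous.
have iQ : leb.-integrable `[a, b] (EFin \o (fun x => g x * Ir b 1 A x)).
  by apply: I; apply: within_continuousM => //; exact: Ir_continuous.
have iGl : leb.-integrable `[a, b] (EFin \o (fun x => g x * Ir b (1 - al) C x)).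
  by apply: I; apply: within_continuousM => //; exact: Ir_continuous.
have iGr : leb.-integrable `[a, b] (EFin \o (fun x => - g x * Il a (1 - be) C x)).
  by apply: I; apply: within_continuousM => //; exact: Il_continuous.
transitivity (\int[leb]_(x in `[a, b]) (g x * Ir b 1 A x + B x * g x +
    cl * (g x * Ir b (1 - al) C x) + cr * (- g x * Il a (1 - be) C x))).
  apply: eq_Rintegral => x _; rewrite /Psi.
  move: (g x) (Ir b 1 A x) (B x) (Ir b (1 - al) C x) (Il a (1 - be) C x) (cl) (cr).
  by move=> *; ring.
transitivity (\int[leb]_(x in `[a, b]) (A x * Il a 1 g x + B x * g x +
    cl * (C x * Il a (1 - al) g x) + cr * (C x * Ir b (1 - be) (fun t => - g t) x))).
  have E1 := @Rintegral_lincomb4 R a b cl cr (fun x => g x * Ir b 1 A x) (fun x => B x * g x)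
    (fun x => g x * Ir b (1 - al) C x) (fun x => - g x * Il a (1 - be) C x) iQ iB iGl iGr.
  have E2 := @Rintegral_lincomb4 R a b cl cr (fun x => A x * Il a 1 g x) (fun x => B x * g x)
    (fun x => C x * Il a (1 - al) g x) (fun x => C x * Ir b (1 - be) (fun t => - g t) x)
    iA iB iCl iCr.
  (* The orders are 1, 1 - al and 1 - be. In the last, C stands under the left integral and -g under
     the right one, the reverse of the other two. *)
  have F1 := fractional_integration_by_parts a b ltr01 cg cA.
  have F2 := fractional_integration_by_parts a b al0 cg cC.
  have F3 := fractional_integration_by_parts a b be0 cC cNg.
  apply: (etrans E1); apply: (etrans _ (esym E2)).
  have L u1 u2 v w1 w2 t1 t2 : u1 = u2 :> R -> w1 = w2 -> t1 = t2 ->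
      u1 + v + cl * w1 + cr * t1 = u2 + v + cl * w2 + cr * t2.
    by move=> -> -> ->.
  exact: (L _ _ _ _ _ _ _ (esym F1) (esym F2) F3).
apply: eq_Rintegral => x; rewrite inE/= => xab.
rewrite (primitive_caputo ab al be ga cg xab) /cl /cr.
move: (g x) (A x) (B x) (C x) (Il a 1 g x) (Il a (1 - al) g x)
  (Ir b (1 - be) (fun t => - g t) x) (Gamma (1 - al))^-1 (Gamma (1 - be))^-1.
by move=> *; ring.
Qed.

Lemma fractional_du_bois_reymond : exists c, {in `[a, b], forall x, Psi x = c}.
Proof. exact: (du_bois_reymond ab cPsi variation_eq0). Qed.

End FractionalDuBoisReymond.

Section EulerLagrange.
Context {R : realType} {N : nat} (a b : R).
Hypothesis ab : a < b.
Variables (al be ga : R).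
Hypotheses (al01 : 0 < al < 1) (be01 : 0 < be < 1).
Notation leb := (@lebesgue_measure R).
Local Notation W := (R * 'rV[R]_N * 'rV[R]_N * 'rV[R]_N)%type.
Variables (nrm : 'rV[R]_N -> R) (L : W -> R) (ya yb : 'rV[R]_N).
Variables (y : R -> 'rV[R]_N) (i : 'I_N).
Hypotheses (nrmP : is_norm nrm) (LC1 : C1_slab a b L)
  (ymin : local_minimizer nrm a b al be ga L ya yb y).

(** Agrees with the lifted curve on [a, b], but is continuous on the line and stays in the slab, as
    [first_variation] demands. *)
Let q := lift_curve a b al be ga y \o clamp a b.
Let A x := dy i L (q x).
Let B x := dyp i L (q x).
Let C x := dD i L (q x).

Let Dy : in_D a b al be ga y. Proof. by case: ymin => -[]. Qed.

Let cq : continuous q.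
Proof. by apply: continuous_clamp_comp; [exact: ltW|exact: in_D_lift_curve]. Qed.

Let q_slab x : slab a b (q x).
Proof. by rewrite /slab/=; apply: clamp_itv; exact: ltW. Qed.

Let continuous_comp_q (f : W -> R) : {within slab a b, continuous f} ->
  continuous (fun x => f (q x)).
Proof. by move=> cf; exact: (continuous_within_comp cf cq q_slab). Qed.

Let cA : continuous A.
Proof. by case: LC1 => _ _ _ /(_ i)[c _ _]; exact: continuous_comp_q c. Qed.
Let cB : continuous B.
Proof. by case: LC1 => _ _ _ /(_ i)[_ c _]; exact: continuous_comp_q c. Qed.
Let cC : continuous C.
Proof. by case: LC1 => _ _ _ /(_ i)[_ _ c]; exact: continuous_comp_q c. Qed.

Lemma variation_primitive (g : R -> R) : continuous g ->
  \int[leb]_(x in `[a, b]) g x = 0 ->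
  \int[leb]_(x in `[a, b]) (A x * Il a 1 g x + B x * g x +
    C x * caputo_comb a b al be ga (Il a 1 g) x) = 0.
Proof.
move=> cg g0; pose h := Il a 1 g.
have [_ [d d0 dmin]] := ymin.
have [[_ yA yB] _] := ymin.
pose s x := (h x, deriv_on a b h x, caputo_comb a b al be ga h x).
have [_ ch'] := primitive_C1 ab cg.
have cs1 : continuous (fun x => (s (clamp a b x)).1.1).
  apply: (@continuous_clamp_comp R _ h a b (ltW ab)).
  exact: Il_continuous.
have cs2 : continuous (fun x => (s (clamp a b x)).1.2).
  exact: (@continuous_clamp_comp R _ (deriv_on a b h) a b (ltW ab)).
have cs3 : continuous (fun x => (s (clamp a b x)).2).
  apply: (@continuous_clamp_comp R _ (caputo_comb a b al be ga h) a b (ltW ab)).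
  exact: primitive_caputo_continuous.
have [K K0 KP] := norm1oo_primitive ab ga al01 be01 i nrmP cg.
(* For |e| < r the perturbation has norm at most |e| K < d; the denominator is positive even when K
   = 0. *)
pose r := d / (K + 1).
have K1 : 0 < K + 1 by rewrite ltr_wpDl.
have r0 : 0 < r by rewrite divr_gt0.
have ha : h a = 0 by rewrite /h Il1E set_itv1 Rintegral_set1.
have hb : h b = 0 by rewrite /h Il1E.
have qE : {in `[a, b], forall x, q x = lift_curve a b al be ga y x}.
  by move=> x xab; rewrite /q/= clamp_id.
have J0 : functional a b al be ga L y = \int[leb]_(x in `[a, b]) L (q x).
  by apply: eq_Rintegral => x; rewrite inE/= => xab; rewrite qE.
have := @first_variation R N a b ab L i LC1 q (s \o clamp a b) cq q_slab cs1 cs2 cs3 r r0.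
have V : forall e : R, `|e| < r -> \int[leb]_(x in `[a, b]) L (q x) <=
     \int[leb]_(x in `[a, b]) L (q x + e *: variation i ((s \o clamp a b) x)).
  move=> e er; pose z t := y t + (e * h t) *: delta_mx 0 i.
  have -> : \int[leb]_(x in `[a, b]) L (q x + e *: variation i ((s \o clamp a b) x)) =
      functional a b al be ga L z.
    apply: eq_Rintegral => x; rewrite inE/= => xab.
    have E := @lift_curve_primitive R N a b ab al be ga al01 be01 g cg y i Dy e x xab.
    by rewrite /q /= (clamp_id xab); exact: (congr1 L (esym E)).
  rewrite -J0; apply: dmin.
    split.
    - exact: primitive_in_D.
    - by rewrite /z ha mulr0 scale0r addr0.
    - by rewrite /z hb mulr0 scale0r addr0.
  apply: (le_lt_trans (KP y e)).
  exact: (mulr_lt_divD1 K0 (normr_ge0 e) er).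
move=> /(_ V) <-; apply: eq_Rintegral => x; rewrite inE/= => xab.
rewrite /partials /= (clamp_id xab) (primitive_deriv ab cg xab).2.
rewrite -/(A x) -/(B x) -/(C x) -/h; ring.
Qed.

Lemma local_minimizer_euler_lagrange x : x \in `[a, b] ->
  euler_lagrange a b al be ga L y i x.
Proof.
move=> xab.
pose Ly t := dy i L (lift_curve a b al be ga y t).
pose Lyp t := dyp i L (lift_curve a b al be ga y t).
pose LD t := dD i L (lift_curve a b al be ga y t).
pose G t := Lyp t - rl_comb_int a b be al (1 - ga) LD t.
suff : (derivable_on a b G x /\ Ly x - deriv_on a b G x = 0) /\
    (rl_comb_exists a b be al (1 - ga) LD x -> derivable_on a b Lyp x /\
     Ly x - deriv_on a b Lyp x + rl_comb a b be al (1 - ga) LD x = 0) by [].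
have AE : {in `[a, b], A =1 Ly} by move=> t tab; rewrite /A /q/= clamp_id.
have BE : {in `[a, b], B =1 Lyp} by move=> t tab; rewrite /B /q/= clamp_id.
have CE : {in `[a, b], C =1 LD} by move=> t tab; rewrite /C /q/= clamp_id.
have [c cP] := fractional_du_bois_reymond ab al01 be01 cA cB cC variation_primitive.
have H t : t \in `[a, b] -> Ir b 1 A t + Lyp t +
     (ga * (Gamma (1 - al))^-1) * Ir b (1 - al) C t -
     ((1 - ga) * (Gamma (1 - be))^-1) * Il a (1 - be) C t = c.
  by move=> tab; rewrite -(BE t tab); exact: (cP t tab).
exact: (euler_lagrange_of_constant ab cA AE CE H xab).
Qed.

End EulerLagrange.

Theorem theorem13 (R : realType) (N : nat)
    (nrm : 'rV[R]_N -> R) (nrmP : is_norm nrm)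
    (a b : R) (ab : a < b)
    (al be ga : R) (al01 : 0 < al < 1) (be01 : 0 < be < 1)
    (ga01 : 0 <= ga <= 1)
    (L : R * 'rV[R]_N * 'rV[R]_N * 'rV[R]_N -> R) (LC1 : C1_slab a b L)
    (ya yb : 'rV[R]_N) (y : R -> 'rV[R]_N) :
  local_minimizer nrm a b al be ga L ya yb y ->
  forall (i : 'I_N) (x : R), x \in `[a, b] ->
    euler_lagrange a b al be ga L y i x.
Proof.
move=> ymin i x.
exact: (local_minimizer_euler_lagrange ab al01 be01 i nrmP LC1 ymin).
Qed.
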